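(* Let $n\ge2$ and let $U:\mathbb{R}\to(-\infty,\infty]$ be measurable, symmetric ($U(x)=U(-x)$), with $\inf U>-\infty$, $0<\int e^{-U}<\infty$, such that $U$ restricted to $[-1,1]$ is twice continuously differentiable and, for some $0<\varepsilon\le1/2$, $U$ has $(1/8,1-\varepsilon)$-controlled gradients on $\mathbb{T}_n^2$. Let $\varphi\sim\mu_{\mathbb{T}_n^2,\mathbf 0,U}$. Then there are constants $C,c>0$ depending only on $U$ and $\varepsilon$ (not on $n$) such that for every $v\in V(\mathbb{T}_n^2)$ with $\|v\|_1\ge(\log n)^2$: \begin{align*} &\operatorname{Var}(\varphi_v)\ge c\log(1+\|v\|_1),\\ &\mathbb{P}(|\varphi_v|\le r)\le C\Big(\frac{r}{\sqrt{\log(1+\|v\|_1)}}\Big)^{2/3}\quad\text{for all } r\ge1,\\ &\mathbb{P}\big(|\varphi_v|\ge t\sqrt{\log(1+\|v\|_1)}\big)\ge c\,e^{-Ct^2}\quad\text{for all }1\le t\le\frac{1+\sqrt{\|v\|_1}}{1+\log n}. \end{align*}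
   Context: For $n\ge1$, $\mathbb{T}_n^2$ is the discrete torus with vertex set $\{-n+1,\dots,n\}^2$, where $(a,b),(c,d)$ are adjacent if they agree in one coordinate and differ by $1$ mod $2n$ in the other; $\mathbf 0=(0,0)$; $\|(v_1,v_2)\|_1=|v_1|+|v_2|$. $\mu_{\mathbb{T}_n^2,\mathbf 0,U}$ is the probability measure with density $Z^{-1}\exp(-\sum_{(v,w)\in E(\mathbb{T}_n^2)}U(\varphi_v-\varphi_w))$ with respect to $\delta_0(d\varphi_{\mathbf 0})\prod_{v\ne\mathbf 0}d\varphi_v$. For $0<L<\infty$, $0<\delta<1$, $U$ has $(\delta,L)$-controlled gradients on $\mathbb{T}_n^2$ if (1) there is $K>L$ with $U(x)<\infty$ for $|x|<K$, and (2) for $\varphi\sim\mu_{\mathbb{T}_n^2,\mathbf 0,U}$ and all $k\ge1$ and distinct edges $e_1,\dots,e_k$, $\mathbb{P}(|\varphi_v-\varphi_w|\ge L \text{ for every } e_i=(v,w))\le\delta^k$. *)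

(* Defs.v *)
From HB Require Import structures.
From mathcomp Require Import all_boot all_order all_algebra.
From mathcomp Require Import all_classical all_reals all_analysis measurable_realfun.
Set Implicit Arguments. Unset Strict Implicit. Unset Printing Implicit Defensive.
Import Order.TTheory GRing.Theory Num.Theory.
Import numFieldNormedType.Exports.
Local Open Scope classical_set_scope.
Local Open Scope ring_scope.

(* Each coordinate ranges over 'I_(2n); the ordinal i stands for the integer
   i - (n-1), so the coordinate set is {-n+1, ..., n} (for n >= 1).
   tsize n = 2n for n >= 1, written so that 'I_(tsize n) is syntactically 'I_k.+1. *)
Definition tsize (n : nat) : nat := (n.-1).*2.+2.
Notation tvert n := ('I_(tsize n) * 'I_(tsize n))%type.

Definition coord (n : nat) (i : 'I_(tsize n)) : int := (i%:Z - (n.-1)%:Z)%R.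

Definition origin (n : nat) : tvert n :=
  (@inord ((n.-1).*2.+1) n.-1, @inord ((n.-1).*2.+1) n.-1).

Definition norm1 (n : nat) (v : tvert n) : int := `|coord v.1| + `|coord v.2|.

Definition cadj (n : nat) (a b : 'I_(tsize n)) : bool :=
  ((a.+1 %% tsize n)%N == b) || ((b.+1 %% tsize n)%N == a).

Definition tadj (n : nat) (v w : tvert n) : bool :=
  ((v.1 == w.1) && cadj v.2 w.2) || ((v.2 == w.2) && cadj v.1 w.1).

(* undirected edges, each represented once as an ordered pair *)
Definition tedge (n : nat) : {set tvert n * tvert n} :=
  [set e | tadj e.1 e.2 && (enum_rank e.1 < enum_rank e.2)%N].

Section Measure.
Variable R : realType.
Variable n : nat.
Variable U : R -> \bar R.

Definition energy (phi : tvert n -> R) : \bar R :=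
  (\sum_(e in tedge n) U (phi e.1 - phi e.2))%E.

Definition weight (phi : tvert n -> R) : \bar R := expeR (- energy phi)%E.

Definition update (phi : tvert n -> R) (v : tvert n) (x : R) : tvert n -> R :=
  fun w => if w == v then x else phi w.

(* iterated Lebesgue integral over the coordinates listed in s
   (for nonnegative measurable f this is the integral w.r.t. the product
   Lebesgue measure, by Tonelli) *)
Fixpoint iint (s : seq (tvert n)) (f : (tvert n -> R) -> \bar R)
    (phi : tvert n -> R) : \bar R :=
  match s with
  | [::] => f phi
  | v :: s' => (\int[lebesgue_measure]_x iint s' f (update phi v x))%E
  end.

(* integral w.r.t. delta_0(d phi_0) prod_{v <> 0} d phi_v *)
Definition tint (f : (tvert n -> R) -> \bar R) : \bar R :=
  iint [seq v <- enum [set: tvert n] | v != origin n] f (fun _ => 0).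

Definition Zpart : \bar R := tint weight.

Definition Emu (g : (tvert n -> R) -> \bar R) : \bar R :=
  (tint (fun phi => g phi * weight phi) * ((fine Zpart)^-1)%:E)%E.

Definition Pmu (A : set (tvert n -> R)) : \bar R :=
  Emu (fun phi => (\1_A phi)%:E).

Definition mean (v : tvert n) : R :=
  fine (Emu (fun phi => (Num.max (phi v) 0)%:E))
  - fine (Emu (fun phi => (Num.max (- phi v) 0)%:E)).

Definition var (v : tvert n) : \bar R :=
  Emu (fun phi => ((phi v - mean v) ^+ 2)%:E).

Definition controlled_gradients (delta L : R) : Prop :=
  (exists K : R, L < K /\ forall x : R, `|x| < K -> (U x < +oo)%E) /\
  forall S : {set tvert n * tvert n}, S \subset tedge n -> S != finset.set0 ->
    (Pmu [set phi | forall e, e \in S -> (L <= `|phi e.1 - phi e.2|)%R]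
       <= (delta ^+ #|S|)%:E)%E.

End Measure.

Definition C2_on_unit (R : realType) (U : R -> \bar R) : Prop :=
  exists g : R -> R,
    (forall x, derivable g x 1) /\
    (forall x, derivable (derive1 g) x 1) /\
    continuous (derive1n 2 g) /\
    (forall x : R, -1 <= x <= 1 -> U x = (g x)%:E).

(* Main.v *)
(* Write w = exp(-U) and split every factor w of the Gibbs weight as w zeta + w (1 - zeta), where the
   cutoff zeta equals 1 on |x| <= 1 - eps and vanishes for |x| >= 1 - eps/2.  Expanding the product over
   the edges turns the measure into a mixture over sets B of closed edges, and given B the field may be
   translated by a deterministic profile s^B that is constant across closed edges: no Jacobian appears.
   Since zeta is the square of a semiconvex function and U is C^2 on [-1, 1], the component p_B satisfies
   p_B(phi)^2 <= exp(C sum_e eta_e^2) p'_B(phi + s^B) p'_B(phi - s^B) as soon as |grad s^B| <= eta, where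
   p'_B belongs to the same measure split with the cutoff zeta + O(eta^2)(1 - zeta).  Translation
   invariance and the AM-GM inequality then compare the law of phi_v with its translates by +-s^B(v).

   Closed edges are dominated by the edges of gradient at least 1 - eps, so by the controlled gradients
   and a Chernoff bound, outside an event of probability O(1/n), at least one edge in twenty is open on
   every self-avoiding path of length 20 log_2 n.  With eta_e = const T / (|e| log |v|) for
   |e| >= const sqrt |v| the first-passage distance from v to 0, closed edges being free, is then at least
   T, so s^B can be taken to vanish at 0 and to equal T at v, while sum_e eta_e^2 = O(T^2 / log |v|).
   A single translation by T = t sqrt(log |v|) gives the tail and variance bounds, and the disjoint
   translates of [-r, r] by multiples of 3 r give the small ball bound.  For the finitely many n that this
   argument leaves out, the tail is bounded below on a small box around theta |.|, theta < 1. *)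
Require Import Defs.
From HB Require Import structures.
From mathcomp Require Import all_boot all_order all_algebra.
From mathcomp Require Import all_classical all_reals all_analysis measurable_realfun.
From mathcomp Require Import ring lra zify.
Import Order.TTheory GRing.Theory Num.Theory.
Import numFieldNormedType.Exports.
Local Open Scope classical_set_scope.
Local Open Scope ring_scope.

(** * Iterated Lebesgue integrals *)

Section TorusIntegral.
Set Implicit Arguments. Unset Strict Implicit. Unset Printing Implicit Defensive.
Context {R : realType}.

Lemma lebesgue_integral_shift (f : R -> \bar R) (a : R) :
  measurable_fun setT f -> (forall x, (0 <= f x)%E) ->
  (\int[lebesgue_measure]_x f (x + a)%R = \int[lebesgue_measure]_x f x)%E.
Proof.
move=> mf f0.
have mphi : measurable_fun setT (fun x : measurableTypeR R => (x + a)%R : measurableTypeR R).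
  exact: measurable_funD.
transitivity (\int[pushforward lebesgue_measure (fun x : measurableTypeR R => (x + a)%R : measurableTypeR R)]_x f x)%E.
  by rewrite ge0_integral_pushforward.
apply: eq_measure_integral => //= A mA _.
apply/esym/lebesgue_measure_unique => //= _ [[u v]] _ <-.
rewrite /pushforward /=.
have -> : (fun x : R => x + a) @^-1` `]u, v] = `]u - a, v - a]%classic.
  apply/seteqP; split => x /=; rewrite !in_itv/=; lra.
rewrite !lebesgue_measure_itv/= !lte_fin ltrD2r.
by case: ifP => // _; rewrite -!EFinB; congr EFin; ring.
Qed.

Lemma lebesgue_integral_opp (f : R -> \bar R) :
  measurable_fun setT f -> (forall x, (0 <= f x)%E) ->
  (\int[lebesgue_measure]_x f (- x)%R = \int[lebesgue_measure]_x f x)%E.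
Proof.
move=> mf f0.
transitivity (\int[pushforward lebesgue_measure (-%R : _ -> measurableTypeR R)]_x f x)%E.
  by rewrite ge0_integral_pushforward.
by apply: eq_measure_integral => //= A mA _; exact: lebesgue_measureN.
Qed.

Variable n : nat.
Local Notation V := (tvert n).
Implicit Types (f g : (V -> R) -> \bar R) (phi psi : V -> R) (s : seq V).

(* Measurability of a function of the field.  Stability under composition with measurable
   parametrisations replaces the product sigma-algebra on [V -> R]: it passes through each one-dimensional integral
   by Tonelli on [T * R]. *)
Definition rfield d1 (rT : measurableType d1) (F : (V -> R) -> rT) := forall d (T : measurableType d) (Phi : T -> V -> R),
  (forall v, measurable_fun setT (fun t => Phi t v)) ->
  measurable_fun setT (fun t => F (Phi t)).

(** Nonnegative measurable functions: the class on which Tonelli, monotonicity and linearity hold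
    without any integrability condition. *)
Definition nnm f := rfield f /\ forall phi, (0 <= f phi)%E.

Lemma measurable_update v : 
  forall d (T : measurableType d) (Phi : T -> V -> R),
  (forall v, measurable_fun setT (fun t => Phi t v)) ->
  forall w, measurable_fun setT (fun z : T * (measurableTypeR R) => update (Phi z.1) v z.2 w).
Proof.
move=> d T Phi mPhi w; rewrite /update.
case: (w == v); first exact: measurable_snd.
by apply: (measurableT_comp (mPhi w)); exact: measurable_fst.
Qed.

Lemma iint_ge0 s f phi : (forall phi, (0 <= f phi)%E) -> (0 <= iint s f phi)%E.
Proof. by move=> f0; elim: s phi => //= v s IH phi; exact: integral_ge0. Qed.

Lemma nnm_iint s f : nnm f -> nnm (iint s f).
Proof.
move=> [mf f0]; split; last by move=> phi; exact: iint_ge0.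
elim: s => //= v s IH d T Phi mPhi.
apply: (measurable_fun_fubini_tonelli_F (m2 := lebesgue_measure)
  (fun z : T * measurableTypeR R => iint s f (update (Phi z.1) v z.2))) => /=.
- by apply: (IH _ _ (fun z : T * measurableTypeR R => update (Phi z.1) v z.2)); exact: measurable_update.
- by move=> z; exact: iint_ge0.
Qed.

Lemma measurable_slice v f phi : nnm f ->
  measurable_fun setT (fun x : measurableTypeR R => f (update phi v x)).
Proof.
move=> [mf _]; apply: (mf _ _ (fun x : measurableTypeR R => update phi v x)) => w.
rewrite /update; case: (w == v) => //.
Qed.

Lemma measurable_iint_slice v s f phi : nnm f ->
  measurable_fun setT (fun x : measurableTypeR R => iint s f (update phi v x)).
Proof. by move=> nf; apply: (@measurable_slice v (iint s f)); exact: nnm_iint. Qed.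

Lemma eq_iint s f g phi : (forall phi, f phi = g phi) -> iint s f phi = iint s g phi.
Proof. by move=> fg; congr iint; apply/funext. Qed.

Lemma le_iint s f g phi : nnm f -> nnm g -> (forall phi, (f phi <= g phi)%E) ->
  (iint s f phi <= iint s g phi)%E.
Proof.
move=> nf ng fg; elim: s phi => //= v s IH phi.
apply: ge0_le_integral => //.
- by move=> x _; apply: iint_ge0; case: nf.
- exact: measurable_iint_slice.
- exact: measurable_iint_slice.
Qed.

Lemma iintD s f g phi : nnm f -> nnm g ->
  iint s (fun phi => f phi + g phi)%E phi = (iint s f phi + iint s g phi)%E.
Proof.
move=> nf ng; elim: s phi => //= v s IH phi.
under eq_integral do rewrite IH.
rewrite ge0_integralD//.
- by move=> x _; apply: iint_ge0; case: nf.
- exact: measurable_iint_slice.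
- by move=> x _; apply: iint_ge0; case: ng.
- exact: measurable_iint_slice.
Qed.

Lemma iintZ s f (c : R) phi : nnm f -> 0 <= c ->
  iint s (fun phi => c%:E * f phi)%E phi = (c%:E * iint s f phi)%E.
Proof.
move=> nf c0; elim: s phi => //= v s IH phi.
under eq_integral do rewrite IH.
rewrite ge0_integralZl_EFin//.
- by move=> x _; apply: iint_ge0; case: nf.
- exact: measurable_iint_slice.
Qed.

Lemma iint0 s phi : iint s (fun=> 0%E) phi = (0%E : \bar R).
Proof. by elim: s phi => //= v s IH phi; under eq_integral do rewrite IH; rewrite integral0. Qed.

Lemma nnm0 : nnm (fun=> 0%E).
Proof. by split. Qed.

Lemma nnmD f g : nnm f -> nnm g -> nnm (fun phi => f phi + g phi)%E.
Proof.
move=> [mf f0] [mg g0]; split; last by move=> phi; apply: adde_ge0.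
move=> d T Phi mPhi; apply: emeasurable_funD; [exact: mf|exact: mg].
Qed.

Lemma nnmM f g : nnm f -> nnm g -> nnm (fun phi => f phi * g phi)%E.
Proof.
move=> [mf f0] [mg g0]; split; last by move=> phi; apply: mule_ge0.
move=> d T Phi mPhi; apply: emeasurable_funM; [exact: mf|exact: mg].
Qed.

Lemma nnm_cst (c : \bar R) : (0 <= c)%E -> nnm (fun=> c).
Proof. by move=> c0; split => // d T Phi _; exact: measurable_cst. Qed.

Lemma nnm_sum (I : Type) (r : seq I) (P : pred I) (F : I -> (V -> R) -> \bar R) :
  (forall i, P i -> nnm (F i)) -> nnm (fun phi => \sum_(i <- r | P i) F i phi)%E.
Proof.
move=> nF; elim: r => [|i r IH].
  by under eq_fun do rewrite big_nil; exact: nnm0.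
under eq_fun do rewrite big_cons.
by case: (boolP (P i)) => // Pi; apply: nnmD => //; exact: nF.
Qed.

Lemma iint_sum (I : Type) (r : seq I) (P : pred I) (F : I -> (V -> R) -> \bar R) s phi :
  (forall i, P i -> nnm (F i)) ->
  iint s (fun phi => \sum_(i <- r | P i) F i phi)%E phi = (\sum_(i <- r | P i) iint s (F i) phi)%E.
Proof.
move=> nF; elim: r => [|i r IH].
  rewrite big_nil; under eq_iint do rewrite big_nil; exact: iint0.
rewrite big_cons; under eq_iint do rewrite big_cons.
case: (boolP (P i)) => // Pi; rewrite iintD ?IH//; first exact: nF.
exact: nnm_sum.
Qed.

Lemma iint_eq_off s f phi psi : (forall v, v \notin s -> phi v = psi v) ->
  iint s f phi = iint s f psi.
Proof.
elim: s phi psi => [|v s IH] phi psi e /=.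
  by congr f; apply/funext => v; exact: e.
apply: eq_integral => x _; apply: IH => w ws; rewrite /update.
by case: eqP => // /eqP wv; apply: e; rewrite inE negb_or wv.
Qed.

(** Translation invariance in each integrated coordinate; frozen coordinates keep their shift, which
    therefore reappears in the base point on the right. *)
Lemma iint_shift s f phi (a : V -> R) : nnm f ->
  iint s (fun psi => f (fun v => psi v + a v)) phi = iint s f (fun v => phi v + a v).
Proof.
move=> nf; elim: s phi => //= v s IH phi.
rewrite -[RHS](@lebesgue_integral_shift _ (a v)); last 2 first.
- exact: measurable_iint_slice.
- by move=> x; apply: iint_ge0; case: nf.
apply: eq_integral => x _; rewrite IH; congr iint; apply/funext => w.
by rewrite /update; case: eqP => [->|].
Qed.

Lemma iint_opp s f phi : nnm f ->
  iint s (fun psi => f (fun v => - psi v)) phi = iint s f (fun v => - phi v).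
Proof.
move=> nf; elim: s phi => //= v s IH phi.
rewrite -[RHS]lebesgue_integral_opp; last 2 first.
- exact: measurable_iint_slice.
- by move=> x; apply: iint_ge0; case: nf.
apply: eq_integral => x _; rewrite IH; congr iint; apply/funext => w.
by rewrite /update; case: ifP.
Qed.

(** Tonelli in the plane; two updates commute because they act at distinct vertices. *)
Lemma iint_swap v w s f phi : v != w -> nnm f ->
  iint (v :: w :: s) f phi = iint (w :: v :: s) f phi.
Proof.
move=> vw nf /=.
pose h (z : measurableTypeR R * measurableTypeR R) := iint s f (update (update phi v z.1) w z.2).
have mh : measurable_fun setT h.
  apply: ((nnm_iint s nf).1 _ _ (fun z : measurableTypeR R * measurableTypeR R => update (update phi v z.1) w z.2)).
  apply: (@measurable_update w _ _ (fun x : measurableTypeR R => update phi v x)) => u.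
  by rewrite /update; case: (u == v).
have h0 z : (0 <= h z)%E by apply: iint_ge0; case: nf.
apply: (eq_trans (fubini_tonelli (m1 := lebesgue_measure) (m2 := lebesgue_measure) h mh h0)).
apply: eq_integral => y _; apply: eq_integral => x _; rewrite /h /=.
congr iint; apply/funext => u; rewrite /update.
by case: (u =P v) => [->|//]; rewrite (negbTE vw).
Qed.

Lemma iint_cat s1 s2 f phi : iint (s1 ++ s2) f phi = iint s1 (iint s2 f) phi.
Proof. by elim: s1 phi => //= v s IH phi; apply: eq_integral => x _; rewrite IH. Qed.

Lemma iint_perm s1 s2 f phi : uniq s1 -> perm_eq s1 s2 -> nnm f ->
  iint s1 f phi = iint s2 f phi.
Proof.
move=> us ps nf.
(* The head of the list travels to its place in the permuted list by adjacent swaps; the induction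
   then runs on the tail. *)
have move_front v s s' : uniq (v :: s ++ s') -> forall phi,
    iint (v :: s ++ s') f phi = iint (s ++ v :: s') f phi.
  elim: s => // w s IH /= /and3P[]; rewrite inE negb_or => /andP[vw vs] ws us' phi'.
  rewrite -/(iint (v :: w :: s ++ s') f phi') iint_swap//=.
  by apply: eq_integral => x _; rewrite -IH//= vs.
elim: s1 s2 us ps phi => [|v s1 IH] s2 us ps phi.
  by rewrite perm_sym in ps; move/perm_nilP: ps => ->.
have vs2 : v \in s2 by rewrite -(perm_mem ps) mem_head.
have us2 : uniq s2 by rewrite -(perm_uniq ps).
move: vs2 ps us2 => /splitPr [p1 p2] ps us2.
rewrite -move_front; last first.
  by move: us2; rewrite -cat1s uniq_catCA.
rewrite /=; apply: eq_integral => x _; apply: IH; first by case/andP: us.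
by rewrite -(perm_cons v) (perm_trans ps)// -cat1s perm_catCA.
Qed.

End TorusIntegral.

(** * Measurable real functions of the field and the pinned reference integral *)

Section RealFields.
Set Implicit Arguments. Unset Strict Implicit. Unset Printing Implicit Defensive.
Context {R : realType}.
Variable n : nat.
Local Notation V := (tvert n).
Implicit Types (F G : (V -> R) -> R) (phi : V -> R).

Lemma rfield_comp d1 d2 (T1 : measurableType d1) (T2 : measurableType d2) (h : T1 -> T2)
    (F : (V -> R) -> T1) :
  measurable_fun setT h -> rfield F -> rfield (fun phi => h (F phi)).
Proof. by move=> mh mF d T Phi mPhi; apply: (measurableT_comp mh); exact: mF. Qed.

Lemma rfield_coord v : rfield (fun phi : V -> R => phi v).
Proof. by move=> d T Phi; exact. Qed.

Lemma rfield_cst d1 (T1 : measurableType d1) (c : T1) : rfield (fun _ : V -> R => c).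
Proof. by move=> d T Phi _; exact: measurable_cst. Qed.

Lemma rfieldM F G : rfield F -> rfield G -> rfield (fun phi => F phi * G phi).
Proof. by move=> mF mG d T Phi mPhi; apply: measurable_funM; [exact: mF|exact: mG]. Qed.

Lemma rfieldD F G : rfield F -> rfield G -> rfield (fun phi => F phi + G phi).
Proof. by move=> mF mG d T Phi mPhi; apply: measurable_funD; [exact: mF|exact: mG]. Qed.

Lemma rfieldB F G : rfield F -> rfield G -> rfield (fun phi => F phi - G phi).
Proof. by move=> mF mG d T Phi mPhi; apply: measurable_funB; [exact: mF|exact: mG]. Qed.

Lemma rfield_prod (I : Type) (r : seq I) (P : pred I) (F : I -> (V -> R) -> R) :
  (forall i, P i -> rfield (F i)) -> rfield (fun phi => \prod_(i <- r | P i) F i phi).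
Proof.
move=> mF; elim: r => [|i r IH] d T Phi mPhi.
  by under eq_fun do rewrite big_nil; exact: measurable_cst.
under eq_fun do rewrite big_cons.
case: (boolP (P i)) => Pi; last exact: IH.
by apply: measurable_funM; [exact: mF|exact: IH].
Qed.

Lemma rfield_bool (b : (V -> R) -> bool) : rfield b -> rfield (fun phi => (b phi)%:R : R).
Proof.
move=> mb; apply: (rfield_comp (h := fun b : bool => b%:R : R)) => //.
Qed.

Lemma nnm_rfield F : rfield F -> (forall phi, 0 <= F phi) -> nnm (fun phi => (F phi)%:E).
Proof.
move=> mF F0; split; last by move=> phi; rewrite lee_fin.
by move=> d T Phi mPhi; apply/measurable_EFinP; exact: mF.
Qed.

Definition free_verts := [seq v <- enum [set: V] | v != origin n].

Lemma mem_free_verts v : (v \in free_verts) = (v != origin n).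
Proof. by rewrite mem_filter mem_enum (mem_set (_ : [set: V] v)) ?andbT. Qed.

Lemma tint_le f g : nnm f -> nnm g -> (forall phi, (f phi <= g phi)%E) ->
  (@tint R n f <= tint g)%E.
Proof. exact: le_iint. Qed.

(** The origin is pinned at 0, so the reference measure is invariant under profiles that vanish
    there. *)
Lemma tint_shift (f : (V -> R) -> \bar R) (a : V -> R) : nnm f -> a (origin n) = 0 ->
  tint (fun psi => f (fun v => psi v + a v)) = tint f.
Proof.
move=> nf a0; rewrite /tint iint_shift//; apply: iint_eq_off => v.
rewrite -/free_verts mem_free_verts negbK => /eqP ->; by rewrite a0 addr0.
Qed.

Lemma tint_opp (f : (V -> R) -> \bar R) : nnm f ->
  tint (fun psi => f (fun v => - psi v)) = tint f.
Proof. by move=> nf; rewrite /tint iint_opp//; congr iint; apply/funext => v; rewrite oppr0. Qed.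

End RealFields.
Arguments free_verts n : clear implicits.

(** * Splitting over closed edges and translation *)

Section Deformation.
Set Implicit Arguments. Unset Strict Implicit. Unset Printing Implicit Defensive.
Context {R : realType}.
Variable n : nat.
Local Notation V := (tvert n).
Variable w : R -> R.
Hypothesis w_ge0 : forall x, 0 <= w x.
Hypothesis mw : measurable_fun setT w.

Definition gweight (phi : V -> R) := \prod_(e in tedge n) w (phi e.1 - phi e.2).

(* Share of [gweight] carried by the configurations whose set of closed edges is [B],
   when an edge of gradient x is independently open with probability [z e x]. *)
Definition edge_factor (z : V * V -> R -> R) (B : {set V * V}) (e : V * V) (x : R) : R :=
  if e \in tedge n then w x * (if e \in B then 1 - z e x else z e x) else (e \notin B)%:R.

Definition bweight z B (phi : V -> R) := \prod_e edge_factor z B e (phi e.1 - phi e.2).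

(** Distributivity applied to the product of w (1 - z) + w z over the edges. A pair that is not an
    edge is split as 0 + 1, so only sets of edges contribute. *)
Lemma sum_bweight z phi : \sum_B bweight z B phi = gweight phi.
Proof.
rewrite /bweight /gweight [RHS]big_mkcond/=.
pose F (e : V * V) := if e \in tedge n then w (phi e.1 - phi e.2) * (1 - z e (phi e.1 - phi e.2)) else 0.
pose G (e : V * V) := if e \in tedge n then w (phi e.1 - phi e.2) * z e (phi e.1 - phi e.2) else 1.
transitivity (\prod_e (F e + G e)).
  rewrite bigA_distr; apply: eq_bigr => B _; apply: eq_bigr => e _.
  by rewrite /edge_factor /F /G; do 2 case: ifP.
apply: eq_bigr => e _; rewrite /F /G; case: ifP => _; ring.
Qed.

Lemma bweight_ge0 z B phi : (forall e x, 0 <= z e x <= 1) -> 0 <= bweight z B phi.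
Proof.
move=> z01; apply: prodr_ge0 => e _; rewrite /edge_factor.
case: ifP => // _; apply: mulr_ge0 => //; have /andP[z0 z1] := z01 e (phi e.1 - phi e.2).
by case: ifP => // _; rewrite subr_ge0.
Qed.

Lemma rfield_bweight z B : (forall e, measurable_fun setT (z e)) -> rfield (bweight z B).
Proof.
move=> mz; apply: rfield_prod => e _.
apply: (rfield_comp (h := edge_factor z B e)); last first.
  by apply: rfieldB; exact: rfield_coord.
rewrite /edge_factor; case: (e \in tedge n) => //; apply: measurable_funM => //.
by case: (e \in B) => //; apply: measurable_funB.
Qed.

Lemma rfield_gweight : rfield gweight.
Proof.
apply: rfield_prod => e _; apply: (rfield_comp (h := w)) => //.
by apply: rfieldB; exact: rfield_coord.
Qed.

Lemma gweight_ge0 phi : 0 <= gweight phi.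
Proof. by apply: prodr_ge0 => e _. Qed.

(** Unnormalised Gibbs measure of the event [b]; the always true event gives the partition
    function. *)
Definition gint (b : (V -> R) -> bool) : \bar R := tint (fun phi => ((b phi)%:R * gweight phi)%:E).

Lemma nnm_gint (b : (V -> R) -> bool) : rfield b -> nnm (fun phi => ((b phi)%:R * gweight phi)%:E).
Proof.
move=> mb; apply: nnm_rfield; last by move=> phi; rewrite mulr_ge0// gweight_ge0.
by apply: rfieldM; [exact: rfield_bool|exact: rfield_gweight].
Qed.

Lemma gint_le (b b' : (V -> R) -> bool) : rfield b -> rfield b' -> (forall phi, b phi -> b' phi) ->
  (gint b <= gint b')%E.
Proof.
move=> mb mb' bb'; apply: tint_le; [exact: nnm_gint|exact: nnm_gint|].
move=> phi; rewrite lee_fin ler_wpM2r// ?gweight_ge0//.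
by case: (b phi) (bb' phi) => // ->.
Qed.

(** AM-GM for the product of lam y and z / lam. The free weight [lam] lets one of the two translates
    be made cheap later on. *)
Lemma weighted_amgm (x y z K lam : R) : 0 <= x -> 0 <= y -> 0 <= z -> 0 <= K -> 0 < lam ->
  x ^+ 2 <= K ^+ 2 * (y * z) -> x <= K / 2 * (lam * y + lam^-1 * z).
Proof.
move=> x0 y0 z0 K0 l0 h.
have rhs0 : 0 <= K / 2 * (lam * y + lam^-1 * z).
  by rewrite mulr_ge0 ?divr_ge0// addr_ge0// mulr_ge0// ?invr_ge0 ltW.
rewrite -(ler_pXn2r (n := 2))// ?nnegrE//; apply: (le_trans h).
rewrite -subr_ge0.
have -> : (K / 2 * (lam * y + lam^-1 * z)) ^+ 2 - K ^+ 2 * (y * z) =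
  (K / 2 * (lam * y - lam^-1 * z)) ^+ 2.
  by field; rewrite gt_eqF.
exact: sqr_ge0.
Qed.

(** The event [a] confines the closed set to good ones. For each good B the share [bweight z B] is
    bounded by the geometric mean of two translated shares, hence by their weighted sum; undoing the
    translations moves the condition [J] on phi v by -T and +T. *)
Lemma deformation (z z' : V * V -> R -> R) (good : pred {set V * V}) (s : {set V * V} -> V -> R)
    (a : (V -> R) -> bool) (J : R -> bool) (v : V) (T K lam : R) :
  (forall e, measurable_fun setT (z e)) -> (forall e x, 0 <= z e x <= 1) ->
  (forall e, measurable_fun setT (z' e)) -> (forall e x, 0 <= z' e x <= 1) ->
  rfield a -> measurable_fun setT J -> 0 <= K -> 0 < lam ->
  (forall B phi, a phi -> bweight z B phi != 0 -> good B) ->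
  (forall B, good B -> s B (origin n) = 0 /\ s B v = T) ->
  (forall B phi, good B -> (bweight z B phi) ^+ 2 <=
     K ^+ 2 * (bweight z' B (fun u => phi u + s B u) * bweight z' B (fun u => phi u - s B u))) ->
  (gint (fun phi => a phi && J (phi v)) <=
   (K / 2)%:E * (lam%:E * gint (fun phi => J (phi v - T)%R) + (lam^-1)%:E * gint (fun phi => J (phi v + T)%R)))%E.
Proof.
move=> mz z01 mz' z'01 ma mJ K0 l0 agood s0 hs.
have l0' := ltW l0; have li0 : 0 <= lam^-1 by rewrite invr_ge0.
pose g1 B phi : R := (J (phi v - T))%:R * bweight z' B phi.
pose g2 B phi : R := (J (phi v + T))%:R * bweight z' B phi.
have mJT (c : R) : rfield (fun phi : V -> R => J (phi v + c)).
  apply: (rfield_comp (h := J)) => //; apply: rfieldD; [exact: rfield_coord|exact: rfield_cst].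
have n1 B : nnm (fun phi => (g1 B phi)%:E).
  apply: nnm_rfield; last by move=> phi; rewrite mulr_ge0// bweight_ge0.
  by apply: rfieldM; [exact/rfield_bool/mJT|exact: rfield_bweight].
have n2 B : nnm (fun phi => (g2 B phi)%:E).
  apply: nnm_rfield; last by move=> phi; rewrite mulr_ge0// bweight_ge0.
  by apply: rfieldM; [exact/rfield_bool/mJT|exact: rfield_bweight].
have sh_nnm f (c : V -> R) : nnm f -> nnm (fun phi : V -> R => f (fun u => phi u + c u) : \bar R).
  move=> [mf f0]; split => // d T' Phi mPhi; apply: (mf _ _ (fun t u => Phi t u + c u)) => u.
  exact: measurable_funD.
pose h1 B phi : \bar R := (g1 B (fun u => phi u + s B u))%:E.
pose h2 B phi : \bar R := (g2 B (fun u => phi u + - s B u))%:E.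
have nh1 B : nnm (h1 B) by apply: (sh_nnm (fun phi => (g1 B phi)%:E)).
have nh2 B : nnm (h2 B) by apply: (sh_nnm (fun phi => (g2 B phi)%:E) (fun u => - s B u)).
have nlh B : nnm (fun phi => lam%:E * h1 B phi + (lam^-1)%:E * h2 B phi)%E.
  by apply: nnmD; apply: nnmM => //; apply: nnm_cst; rewrite lee_fin.
have nKlh B : nnm (fun phi => (K / 2)%:E * (lam%:E * h1 B phi + (lam^-1)%:E * h2 B phi))%E.
  by apply: nnmM => //; apply: nnm_cst; rewrite lee_fin divr_ge0.
have K20 : 0 <= K / 2 by rewrite divr_ge0.
have step1 : (gint (fun phi => a phi && J (phi v)) <=
   tint (fun phi => \sum_(B | good B) (K / 2)%:E * (lam%:E * h1 B phi + (lam^-1)%:E * h2 B phi)))%E.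
  apply: tint_le.
  - apply: nnm_gint => d T' Phi mPhi; apply: measurable_and; first exact: ma.
    exact: (measurableT_comp mJ).
  - exact: nnm_sum.
  move=> phi.
  have -> : (\sum_(B | good B) (K / 2)%:E * (lam%:E * h1 B phi + (lam^-1)%:E * h2 B phi) =
    (\sum_(B | good B) (K / 2) * (lam * g1 B (fun u => phi u + s B u)
       + lam^-1 * g2 B (fun u => phi u + - s B u)))%:E)%E.
    by rewrite -sumEFin.
  rewrite lee_fin.
  have rhs0 B : 0 <= K / 2 * (lam * g1 B (fun u => phi u + s B u)
       + lam^-1 * g2 B (fun u => phi u + - s B u)).
    by rewrite mulr_ge0// addr_ge0// !mulr_ge0// bweight_ge0.
  case: (boolP (a phi && J (phi v))) => [/andP[aphi Jphi]|_]; last first.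
    by rewrite mul0r sumr_ge0.
  (* On the event [a], sets that are not good have zero share and drop out of the expansion. *)
  rewrite mul1r -(sum_bweight z) (bigID good)/= [X in _ + X]big1 ?addr0; last first.
    move=> B ngB; apply/eqP; apply: contraNT ngB => h; exact: agood aphi h.
  apply: ler_sum => B gB; have [_ sv] := s0 _ gB.
  rewrite /g1 /g2 /= sv addrK subrK Jphi !mul1r.
  by apply: weighted_amgm; rewrite ?bweight_ge0//; exact: hs.
apply: (le_trans step1).
rewrite /tint iint_sum// -/(free_verts n).
(* The two shifts disappear by translation invariance, as [s B] vanishes at the origin. *)
have -> : \sum_(B | good B) iint (free_verts n) (fun phi => (K / 2)%:E * (lam%:E * h1 B phi + (lam^-1)%:E * h2 B phi))%E (fun=> 0)
  = (\sum_(B | good B) (K / 2)%:E * (lam%:E * tint (fun phi => (g1 B phi)%:E) + (lam^-1)%:E * tint (fun phi => (g2 B phi)%:E)))%E.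
  apply: eq_bigr => B gB; rewrite iintZ// iintD; last 2 first.
  - by apply: nnmM => //; apply: nnm_cst; rewrite lee_fin.
  - by apply: nnmM => //; apply: nnm_cst; rewrite lee_fin.
  rewrite !iintZ//; congr (_ * (_ * _ + _ * _))%E.
  - by rewrite -[RHS](@tint_shift _ _ _ (s B))//; have [] := s0 _ gB.
  - by rewrite -[RHS](@tint_shift _ _ _ (fun u => - s B u))//; have [-> _] := s0 _ gB; rewrite oppr0.
have tge0 (f : (V -> R) -> \bar R) : nnm f -> (0 <= tint f)%E by move=> [_ f0]; exact: iint_ge0.
have term0 B : (0 <= (K / 2)%:E * (lam%:E * tint (fun phi => (g1 B phi)%:E) + (lam^-1)%:E * tint (fun phi => (g2 B phi)%:E)))%E.
  by rewrite mule_ge0// adde_ge0// mule_ge0// tge0.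
(* The sum is enlarged to all B, so that the shares for z' add up to the full Gibbs weight again. *)
apply: (@le_trans _ _ (\sum_B (K / 2)%:E * (lam%:E * tint (fun phi => (g1 B phi)%:E) + (lam^-1)%:E * tint (fun phi => (g2 B phi)%:E)))%E).
  by rewrite [leRHS](bigID good)/= leeDl// sume_ge0.
rewrite -ge0_sume_distrr; last by move=> B _; rewrite adde_ge0// mule_ge0// tge0.
rewrite lee_wpmul2l// big_split/= -!ge0_sume_distrr; last 2 first.
- by move=> B _; rewrite tge0.
- by move=> B _; rewrite tge0.
rewrite /tint -!iint_sum//.
have e (b : (V -> R) -> bool) : iint (free_verts n) (fun phi => \sum_B ((b phi)%:R * bweight z' B phi)%:E)%E (fun=> 0) = gint b.
  by apply: eq_iint => phi; rewrite sumEFin -mulr_sumr sum_bweight.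
by rewrite -/(free_verts n) !e.
Qed.

End Deformation.

(** * Paths and first passage on the torus *)

Section TorusGraph.
Local Notation coord := Defs.coord.
Local Notation tsize := Defs.tsize.
Set Implicit Arguments. Unset Strict Implicit. Unset Printing Implicit Defensive.
Variable n : nat.
Local Notation V := (tvert n).
Implicit Types (x y u v : V) (p : seq V).

Definition nrm v : nat := (`|coord v.1|%N + `|coord v.2|%N)%N.

Lemma norm1E v : norm1 v = (nrm v)%:Z.
Proof. by rewrite /norm1 /nrm PoszD !abszE. Qed.

Lemma nrm_origin : nrm (origin n) = 0%N.
Proof.
have h : (n.-1 < (n.-1).*2.+2)%N by rewrite -addnn; lia.
by rewrite /nrm /coord /origin /= inordK// subrr.
Qed.

Lemma cadj_sym : symmetric (@cadj n).
Proof. by move=> a b; rewrite /cadj orbC. Qed.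

Lemma tadj_sym : symmetric (@tadj n).
Proof. by move=> x y; rewrite /tadj (eq_sym x.1) (eq_sym x.2) (cadj_sym x.1) (cadj_sym x.2). Qed.

(** The only edge that is not a unit step joins the coordinates n and -n + 1, whose absolute values
    also differ by 1. *)
Lemma cadj_step (a b : 'I_(tsize n)) : cadj a b ->
  (`|coord a| <= `|coord b| + 1)%N.
Proof.
have la := ltn_ord a; have lb := ltn_ord b.
have step (c : nat) : (c < tsize n)%N ->
    ((c.+1 %% tsize n)%N = c.+1 /\ (c.+1 < tsize n)%N) \/ ((c.+1 %% tsize n)%N = 0%N /\ c = (tsize n).-1).
  move=> lc; case: (ltnP c.+1 (tsize n)) => h; first by left; rewrite modn_small.
  right; have -> : c.+1 = tsize n by apply/eqP; rewrite eqn_leq lc h.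
  by rewrite modnn; split => //; lia.
rewrite /cadj /coord; move: (nat_of_ord a) (nat_of_ord b) la lb => i j la lb.
rewrite /tsize in la lb step *; move: (n.-1) la lb step => m la lb step.
case/orP => /eqP e.
- by case: (step i la) => [[e1 h]|[e1 h]]; rewrite e1 in e; lia.
- by case: (step j lb) => [[e1 h]|[e1 h]]; rewrite e1 in e; lia.
Qed.

Lemma nrm_step x y : tadj x y -> (nrm x <= nrm y + 1)%N.
Proof.
rewrite /nrm; case/orP => /andP[/eqP -> /cadj_step h]; lia.
Qed.

Lemma nrm_last x p u : path (@tadj n) x p -> u \in x :: p ->
  (nrm u <= nrm (last x p) + size p)%N /\ (nrm (last x p) <= nrm u + size p)%N.
Proof.
elim: p x u => [|y p IH] x u /=.
  by move=> _; rewrite inE => /eqP ->; lia.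
move=> /andP[xy yp]; rewrite inE => /predU1P[->|up]; last by have := IH _ _ yp up; lia.
have := IH _ _ yp (mem_head _ _); have := nrm_step xy.
rewrite tadj_sym in xy; have := nrm_step xy; lia.
Qed.

(** Orients an adjacent pair the way [tedge] stores it, so that edges met along a path can be
    compared with [tedge]. *)
Definition ed x y : V * V := if (enum_rank x < enum_rank y)%N then (x, y) else (y, x).

Lemma ed_sub x y : (ed x y).1 \in [:: x; y] /\ (ed x y).2 \in [:: x; y].
Proof. by rewrite /ed; case: ifP; rewrite !inE !eqxx !orbT. Qed.

Lemma tadj_irr x : tadj x x = false.
Proof.
have irr (c : 'I_(tsize n)) : cadj c c = false.
  have lc := ltn_ord c; rewrite /cadj orbb; apply/negbTE/eqP.
  case: (ltnP c.+1 (tsize n)) => h; first by rewrite modn_small//; lia.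
  have -> : c.+1 = tsize n by apply/eqP; rewrite eqn_leq lc h.
  rewrite modnn /tsize in h *; move: (nat_of_ord c) h; lia.
by rewrite /tadj !irr !andbF.
Qed.

Lemma ed_tedge x y : tadj x y -> ed x y \in tedge n.
Proof.
move=> xy; rewrite inE /ed; case: ltngtP => //= h.
- by rewrite xy.
- by rewrite tadj_sym xy h.
by move: xy; rewrite (enum_rank_inj (val_inj h)) tadj_irr.
Qed.

Lemma ed_id (e : V * V) : e \in tedge n -> ed e.1 e.2 = e /\ ed e.2 e.1 = e.
Proof.
by rewrite inE => /andP[_ h]; rewrite /ed h ltnNge (ltnW h) /=; case: e h.
Qed.

Definition path_edges x p := pairmap ed x p.

Lemma mem_path_edges x p e : e \in path_edges x p -> e.1 \in x :: p /\ e.2 \in x :: p.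
Proof.
elim: p x => //= y p IH x; rewrite inE => /predU1P[->|/IH[h1 h2]].
  by have [] := ed_sub x y; rewrite !inE => /orP[]/eqP-> /orP[]/eqP->; rewrite !eqxx ?orbT.
by rewrite inE h1 orbT inE h2 orbT.
Qed.

Lemma path_edges_tedge x p e : path (@tadj n) x p -> e \in path_edges x p -> e \in tedge n.
Proof.
elim: p x => //= y p IH x /andP[xy yp]; rewrite inE => /predU1P[->|]; first exact: ed_tedge.
exact: IH.
Qed.

(** The first edge contains the starting vertex, which a self-avoiding path never visits again. *)
Lemma uniq_path_edges x p : uniq (x :: p) -> uniq (path_edges x p).
Proof.
elim: p x => //= y p IH x /andP[]; rewrite inE negb_or => /andP[xy xp] yp.
rewrite IH// andbT; apply/negP => /mem_path_edges[]; rewrite /ed.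
case: ifP => _ /=; rewrite !inE (negbTE xy) (negbTE xp)//.
Qed.

Definition cstep (a : 'I_(tsize n)) (b : bool) : 'I_(tsize n) := if b then ordS a else ord_pred a.

Lemma cadjP (a b : 'I_(tsize n)) : cadj a b -> exists c, b = cstep a c.
Proof.
case/orP => /eqP h; first by exists true; apply: val_inj; rewrite /= h.
exists false => /=; rewrite -[b]ordSK; congr ord_pred; exact: val_inj.
Qed.

Definition tstep x (d : bool * bool) : V :=
  if d.1 then (x.1, cstep x.2 d.2) else (cstep x.1 d.2, x.2).

Lemma tadjP x y : tadj x y -> exists d, y = tstep x d.
Proof.
case: x y => [x1 x2] [y1 y2] /orP[]/andP[/= /eqP e /cadjP[c ec]].
- by exists (true, c); rewrite /tstep /= e ec.
- by exists (false, c); rewrite /tstep /= e ec.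
Qed.

Lemma degree_le4 x : (#|[set y | tadj x y]%SET| <= 4)%N.
Proof.
have -> : 4%N = #|{: bool * bool}| by rewrite card_prod card_bool.
rewrite -cardsT; apply: leq_trans (leq_imset_card (tstep x) _).
apply/subset_leq_card/fintype.subsetP => y; rewrite inE => /tadjP[d ->].
exact: imset_f.
Qed.

Fixpoint twalk x (ds : seq (bool * bool)) : seq V :=
  if ds is d :: ds' then tstep x d :: twalk (tstep x d) ds' else [::].

Lemma size_twalk x ds : size (twalk x ds) = size ds.
Proof. by elim: ds x => //= d ds IH x; rewrite IH. Qed.

(** A path is determined by its starting point and one of four directions per step. *)
Lemma card_paths x L : (#|[set p : L.-tuple V | path (@tadj n) x p]%SET| <= 4 ^ L)%N.
Proof.
have sz (ds : L.-tuple (bool * bool)) : size (twalk x ds) == L by rewrite size_twalk size_tuple.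
have -> : (4 ^ L)%N = #|{: L.-tuple (bool * bool)}| by rewrite card_tuple card_prod card_bool.
rewrite -cardsT; apply: leq_trans (leq_imset_card (fun ds => Tuple (sz ds)) _).
apply/subset_leq_card/fintype.subsetP => p; rewrite inE => pp.
suff [ds e] : exists ds : L.-tuple (bool * bool), twalk x ds = p.
  by apply/imsetP; exists ds => //; apply: val_inj.
elim: L x p pp {sz} => [|L IH] x p; first by move=> _; exists [tuple]; rewrite (tuple0 p).
case/tupleP: p => y p /= /andP[/tadjP[d ->]] /IH[ds e].
by exists [tuple of d :: ds] => /=; rewrite e.
Qed.

End TorusGraph.

(** * First-passage distance with free closed edges *)

Section FirstPassage.
Set Implicit Arguments. Unset Strict Implicit. Unset Printing Implicit Defensive.
Context {R : realType}.
Variables n l : nat.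
Local Notation V := (tvert n).
Implicit Types (x y u v : V) (p : seq V) (B : {set V * V}).

(* [B] is the set of closed edges. *)
Definition good_set B : bool := `[< forall x p, path (@tadj n) x p -> uniq (x :: p) ->
  size p = (20 * l)%N -> (l <= count [predC B] (path_edges x p))%N >].

Lemma good_setS B B' : B' \subset B -> good_set B -> good_set B'.
Proof.
move=> /fintype.subsetP BB' /asboolP h; apply/asboolP => x p xp up sp.
apply: leq_trans (h x p xp up sp) _; apply: sub_count => e /=; exact/contra/BB'.
Qed.

Variables (eta : V * V -> R) (B : {set V * V}).
Hypothesis eta0 : forall e, 0 <= eta e.

(** A closed edge costs nothing, which forces a profile with gradient at most [edge_cost] to be
    constant across it. *)
Definition edge_cost (e : V * V) : R := if e \in B then 0 else eta e.
Definition path_cost x p : R := \sum_(e <- path_edges x p) edge_cost e.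

Lemma edge_cost_ge0 e : 0 <= edge_cost e.
Proof. by rewrite /edge_cost; case: ifP. Qed.

Lemma path_cost_ge0 x p : 0 <= path_cost x p.
Proof. by apply: sumr_ge0 => e _; exact: edge_cost_ge0. Qed.

Lemma path_cost_cons x y p : path_cost x (y :: p) = edge_cost (ed x y) + path_cost y p.
Proof. by rewrite /path_cost /= big_cons. Qed.

Lemma path_cost_cat x p q : path_cost x (p ++ q) = path_cost x p + path_cost (last x p) q.
Proof. by rewrite /path_cost /path_edges pairmap_cat big_cat. Qed.

(** Loop erasure: the cost of a removed loop is nonnegative. *)
Lemma uniq_path_cost x p : path (@tadj n) x p -> exists p',
  [/\ path (@tadj n) x p', uniq (x :: p'), last x p' = last x p & path_cost x p' <= path_cost x p].
Proof.
elim: p x => [|y p IH] x /=; first by move=> _; exists [::].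
move=> /andP[xy yp]; have [q [yq uq lq cq]] := IH _ yp.
have [xq|xq] := boolP (x \in y :: q); last first.
  exists (y :: q); split => /=; rewrite ?xy ?yq//; first by rewrite xq.
  by rewrite !path_cost_cons lerD2l.
have [p1 [p2 e]] : exists p1 p2, y :: q = p1 ++ x :: p2.
  by case/splitPr: xq => p1 p2; exists p1, p2.
exists p2.
have px2 : path (@tadj n) x p2.
  case: p1 e => [[<- <-]//|z p1 [_ e]]; by move: yq; rewrite e cat_path /= => /and3P[].
have cx2 : path_cost x p2 <= path_cost y q.
  case: p1 e => [[<- <-]//|z p1 [_ ->]].
  by rewrite path_cost_cat path_cost_cons addrA lerDr addr_ge0// ?path_cost_ge0 ?edge_cost_ge0.
split => //.
- by move: uq; rewrite e cat_uniq => /and3P[].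
- rewrite -lq; have := congr1 (last x) e; rewrite /= => ->; by rewrite last_cat.
- by rewrite path_cost_cons (le_trans cx2)// (le_trans cq)// lerDr edge_cost_ge0.
Qed.

(* Induction on the length of the path: its first 20 l edges contain at least l open ones, which pay
   for the decrease of S along them. *)
Lemma passage_time_ge (S : nat -> R) x p : good_set B ->
  (forall r, (r < 20 * l)%N -> S r <= 0) ->
  (forall r q : nat, (r <= q + 20 * l)%N -> exists m, [/\ 0 <= m, S r - S q <= l%:R * m &
     forall e, e \in tedge n -> (nrm e.1 <= q + 20 * l)%N -> (q <= nrm e.1 + 20 * l)%N -> m <= eta e]) ->
  (0 < l)%N ->
  path (@tadj n) x p -> uniq (x :: p) -> last x p = origin n -> S (nrm x) <= path_cost x p.
Proof.
move=> /asboolP gB S0 Sinc l0.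
elim: {p}(size p) {-2}p x (leqnn (size p)) => [|N IH] p x sp xp up lp.
  apply: le_trans (path_cost_ge0 _ _); apply: S0.
  by move: sp lp; rewrite leqn0 => /nilP -> /= ->; rewrite nrm_origin muln_gt0.
(* A path of fewer than 20 l steps to the origin starts at norm below 20 l, where [S] is
   nonpositive. *)
case: (ltnP (size p) (20 * l)) => hs.
  apply: le_trans (path_cost_ge0 _ _); apply: S0; apply: leq_ltn_trans hs.
  by have := nrm_last xp (mem_head _ _); rewrite lp nrm_origin => -[].
pose p1 := take (20 * l) p; pose p2 := drop (20 * l) p.
have ep : p = p1 ++ p2 by rewrite cat_take_drop.
have sp1 : size p1 = (20 * l)%N by rewrite size_takel.
move: xp up lp; rewrite ep cat_path last_cat => /andP[xp1 xp2] up lp.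
have up1 : uniq (x :: p1) by move: up; rewrite -cat_cons cat_uniq => /and3P[].
set y := last x p1 in xp2 lp.
have up2 : uniq (y :: p2).
  move: up; rewrite /y; case/lastP: (p1) => [|p1' z] //; rewrite last_rcons cat_rcons -cat_cons cat_uniq.
  by case/and3P.
have sp2 : (size p2 <= N)%N by rewrite size_drop; lia.
have IHy := IH _ _ sp2 xp2 up2 lp.
rewrite path_cost_cat -/y.
have [] := nrm_last xp1 (mem_head _ _); rewrite sp1 -/y => nx ny.
have [m [m0 Sm me]] := Sinc _ _ nx.
suff : l%:R * m <= path_cost x p1 by lra.
apply: (@le_trans _ _ (\sum_(e <- path_edges x p1 | e \notin B) m)).
  rewrite big_const_seq iter_addr_0 -[m *+ _]mulr_natl ler_wpM2r// ler_nat; exact: gB.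
rewrite /path_cost [leRHS](bigID (mem B))/= [X in _ <= X + _]big1 ?add0r; last by move=> e eB; rewrite /edge_cost eB.
rewrite big_seq_cond [leRHS]big_seq_cond; apply: ler_sum => e /andP[ep1 eB].
rewrite /edge_cost (negbTE eB); have [e1 _] := mem_path_edges ep1.
have [] := nrm_last xp1 e1; rewrite sp1 -/y => h1 h2.
by apply: me => //; exact: path_edges_tedge ep1.
Qed.

(* The profile is u |-> sup (T - cost of p)^+ over the walks p from v to u. *)
Lemma exists_profile v (T : R) : 0 <= T ->
  (forall p, path (@tadj n) v p -> uniq (v :: p) -> last v p = origin n -> T <= path_cost v p) ->
  exists s : V -> R, [/\ s (origin n) = 0, s v = T &
    forall e, e \in tedge n -> `|s e.1 - s e.2| <= edge_cost e].
Proof.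
move=> T0 hT.
pose A u : set R := [set t | t = 0 \/ exists p, [/\ path (@tadj n) v p, last v p = u & t = T - path_cost v p]].
have A0 u : A u !=set0 by exists 0; left.
have ubA u : ubound (A u) T.
  by move=> t [->//|[p [_ _ ->]]]; rewrite lerBlDr lerDl path_cost_ge0.
have hA u : has_sup (A u) by split => //; exists T.
have leA u t : A u t -> t <= sup (A u) by move=> At; apply: sup_upper_bound.
have supA u t : (forall z, A u z -> z <= t) -> sup (A u) <= t by move=> h; apply: ge_sup.
exists (fun u => sup (A u)); split.
(* At the origin every walk costs at least T after loop erasure, so the truncation value 0 is the
   supremum. *)
- apply/eqP; rewrite eq_le leA ?andbT; last by left.
  apply: supA => z [->//|[p [vp lp ->]]]; rewrite subr_le0.
  have [q [vq uq lq cq]] := uniq_path_cost vp.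
  by apply: le_trans cq; apply: hT; rewrite // lq.
- apply/eqP; rewrite eq_le; apply/andP; split; first by apply: supA; exact: ubA.
  by apply: leA; right; exists [::]; rewrite /path_cost big_nil subr0.
(* Appending the step to u' to a walk ending at u lowers its value by exactly the cost of that
   edge. *)
have lip u u' : tadj u u' -> sup (A u) - edge_cost (ed u u') <= sup (A u').
  move=> uu'; rewrite lerBlDr; apply: supA => z [->|[p [vp lp ->]]].
    by rewrite addr_ge0 ?edge_cost_ge0// leA//; left.
  rewrite -lerBlDr; apply: leA; right; exists (rcons p u'); split.
  - by rewrite rcons_path vp lp.
  - by rewrite last_rcons.
  - by rewrite -cats1 path_cost_cat lp path_cost_cons /path_cost big_nil addr0 opprD addrA.
move=> e eE; have [e1 e2] := ed_id eE.
have ae : tadj e.1 e.2 by move: eE; rewrite inE => /andP[].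
have := lip _ _ ae; rewrite e1; rewrite tadj_sym in ae; have := lip _ _ ae; rewrite e2.
by rewrite ler_norml; lra.
Qed.

End FirstPassage.

(** * Percolation of closed edges *)

Section Percolation.
Set Implicit Arguments. Unset Strict Implicit. Unset Printing Implicit Defensive.
Context {R : realType}.
Variables n l : nat.
Local Notation V := (tvert n).
Variable w : R -> R.
Hypothesis w_ge0 : forall x, 0 <= w x.
Hypothesis mw : measurable_fun setT w.
Variable h : R.

Definition closed_edges (phi : V -> R) : {set V * V} :=
  [set e in tedge n | h <= `|phi e.1 - phi e.2|]%SET.

Lemma rfield_big_and (I : Type) (r : seq I) (b : I -> (V -> R) -> bool) :
  (forall i, rfield (b i)) -> rfield (fun phi => all (fun i => b i phi) r).
Proof.
move=> mb d T Phi mPhi; elim: r => [|i r IH] /=; first exact: measurable_cst.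
by apply: measurable_and => //; exact: mb.
Qed.

Lemma rfield_not (b : (V -> R) -> bool) : rfield b -> rfield (fun phi => ~~ b phi).
Proof. by move=> mb d T Phi mPhi; apply: measurable_neg; exact: mb. Qed.

Lemma rfield_and (b c : (V -> R) -> bool) : rfield b -> rfield c ->
  rfield (fun phi => b phi && c phi).
Proof. by move=> mb mc d T Phi mPhi; apply: measurable_and; [exact: mb|exact: mc]. Qed.

Lemma rfield_closed e : rfield (fun phi : V -> R => h <= `|phi e.1 - phi e.2|).
Proof.
have mD : rfield (fun phi : V -> R => phi e.1 - phi e.2) by apply: rfieldB; exact: rfield_coord.
move=> d T Phi mPhi; apply: measurable_fun_ler; first exact: measurable_cst.
by apply: measurableT_comp => //; exact: mD.
Qed.

Lemma rfield_closed_edges_eq B : rfield (fun phi => closed_edges phi == B).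
Proof.
have -> : (fun phi => closed_edges phi == B) =
  (fun phi => all (fun e => (if e \in B then (e \in tedge n) && (h <= `|phi e.1 - phi e.2|)
     else (e \notin tedge n) || ~~ (h <= `|phi e.1 - phi e.2|))) (enum {: V * V})).
  apply/funext => phi; apply/eqP/allP => [<- e _|hB].
    by rewrite inE; case: ifP => //; rewrite -negb_and => ->.
  apply/setP => e; have := hB e; rewrite mem_enum => /(_ isT) hBe; rewrite inE; move: hBe.
  by case: ifP => // _; rewrite -negb_and => /negbTE.
apply: rfield_big_and => e; case: (e \in B); case: (e \in tedge n) => //=.
- exact: rfield_closed.
- exact/rfield_not/rfield_closed.
Qed.

(** There are finitely many possible closed sets, so any property of the closed set is a finite
    conjunction of measurable events. *)
Lemma rfield_closed_edges (b : pred {set V * V}) : rfield (fun phi => b (closed_edges phi)).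
Proof.
have -> : (fun phi => b (closed_edges phi)) = (fun phi => all (fun B => ~~ ((closed_edges phi == B) && ~~ b B)) (enum {: {set V * V}})).
  apply/funext => phi; apply/idP/allP => [bp B _|hB].
    by rewrite negb_and negbK; case: eqP => //= <-.
  by have := hB (closed_edges phi); rewrite mem_enum eqxx negbK; exact.
apply: rfield_big_and => B; apply: rfield_not; apply: rfield_and; last exact: rfield_cst.
exact: rfield_closed_edges_eq.
Qed.

Lemma sum_subset_expr (T : finType) (A : {set T}) (y : R) :
  \sum_(S : {set T} | S \subset A) y ^+ #|S| = (1 + y) ^+ #|A|.
Proof.
pose F (i : T) := if i \in A then y else 0.
transitivity (\prod_(i : T) (F i + 1)).
  rewrite bigA_distr big_mkcond; apply: eq_bigr => S _.
  rewrite -big_mkcond/=; case: ifP => [/fintype.subsetP SA|].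
    rewrite -prodr_const; apply: eq_bigr => i iS; by rewrite /F SA.
  move=> /negbT/fintype.subsetPn[i iS iA]; by rewrite (bigD1 i)//= /F (negbTE iA) mul0r.
rewrite (bigID (mem A))/= [X in _ * X]big1 ?mulr1; last first.
  by move=> i iA; rewrite /F (negbTE iA) add0r.
rewrite -prodr_const; apply: eq_bigr => i iA; by rewrite /F iA addrC.
Qed.

(** Equals 15^(closed edges on the path - 19 l), written as a sum over subsets because the
    controlled gradients bound exactly the probabilities that all edges of a given set S are
    closed. *)
Definition path_weight (x : V) (p : seq V) (phi : V -> R) : R :=
  (15 ^- (19 * l)) * \sum_(S : {set V * V} | S \subset [set e in path_edges x p]%SET)
     14 ^+ #|S| * (S \subset closed_edges phi)%:R.

Lemma path_weight_ge0 x p phi : 0 <= path_weight x p phi.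
Proof.
rewrite /path_weight mulr_ge0 ?invr_ge0 ?exprn_ge0//.
by apply: sumr_ge0 => S _; rewrite mulr_ge0 ?exprn_ge0.
Qed.

(* Chernoff: 14^|S| is the expansion of 15^(number of closed edges). *)
Lemma path_weight_ge1 x p phi : path (@tadj n) x p -> uniq (x :: p) -> size p = (20 * l)%N ->
  (count [predC closed_edges phi] (path_edges x p) < l)%N -> 1 <= path_weight x p phi.
Proof.
move=> xp up sp cl.
rewrite /path_weight.
have -> : \sum_(S : {set V * V} | S \subset [set e in path_edges x p]%SET)
     14 ^+ #|S| * (S \subset closed_edges phi)%:R =
   (1 + 14) ^+ #|[set e in path_edges x p]%SET :&: closed_edges phi| :> R.
  rewrite -sum_subset_expr big_mkcond [RHS]big_mkcond; apply: eq_bigr => S _.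
  by rewrite finset.subsetI; case: (S \subset [set e in path_edges x p]%SET) => //=; case: ifP; rewrite ?mulr1 ?mulr0.
have le19 : (19 * l <= #|[set e in path_edges x p]%SET :&: closed_edges phi|)%N.
  have -> : #|[set e in path_edges x p]%SET :&: closed_edges phi| = count (mem (closed_edges phi)) (path_edges x p).
    rewrite -size_filter -(card_uniqP _); last by rewrite filter_uniq// uniq_path_edges.
    by apply: eq_card => e; rewrite inE mem_filter inE andbC.
  have := count_predC (mem (closed_edges phi)) (path_edges x p).
  rewrite size_pairmap sp; move: cl.
  rewrite (eq_count (a2 := predC (mem (closed_edges phi))))//; lia.
have -> : 1 + 14 = 15 :> R by ring.
rewrite mulrC ler_pdivlMr ?exprn_gt0// mul1r ler_weXn2l//; lra.
Qed.

Definition simple_paths (x : V) := [set p : (20 * l).-tuple V | path (@tadj n) x p && uniq (x :: p)]%SET.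

(** Union bound over starting points and self-avoiding paths of length 20 l: failure of [good_set]
    makes one summand at least 1. *)
Lemma not_good_path_weight phi : ~~ good_set l (closed_edges phi) ->
  1 <= \sum_x \sum_(p in simple_paths x) path_weight x p phi.
Proof.
move=> /asboolPn /existsNP[x] /existsNP[p] /not_implyP[xp] /not_implyP[up] /not_implyP[sp] /negP.
rewrite -ltnNge => cl.
have sp' : size p == (20 * l)%N by apply/eqP.
rewrite (bigD1 x)//= (bigD1 (Tuple sp'))/=; last by rewrite inE xp up.
apply: (le_trans (path_weight_ge1 xp up sp cl)).
rewrite -addrA lerDl addr_ge0//; first by apply: sumr_ge0 => ? _; exact: path_weight_ge0.
by do 2 (apply: sumr_ge0 => ? _); exact: path_weight_ge0.
Qed.

Hypothesis closed_prob : forall S : {set V * V}, S \subset tedge n ->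
  (gint w (fun phi : V -> R => S \subset closed_edges phi) <= ((1 / 8) ^+ #|S|)%:E * gint w (fun _ : V -> R => true))%E.

(** The expected weight of one path is at most 15^(-19 l) (1 + 14/8)^(20 l), and at most 4^(20 l)
    paths leave each vertex. Since 4 (1 + 14/8) = 11, each unit of l contributes 11^20 / 15^19,
    which is below 1/8. *)
Lemma not_good_prob :
  (gint w (fun phi : V -> R => ~~ good_set l (closed_edges phi)) <=
    (#|{: V}|%:R * (1 / 8) ^+ l)%:E * gint w (fun _ : V -> R => true))%E.
Proof.
pose term (S : {set V * V}) (phi : V -> R) : \bar R :=
  ((15 ^- (19 * l) * 14 ^+ #|S|)%:E * ((S \subset closed_edges phi)%:R * gweight w phi)%:E)%E.
have mS (S : {set V * V}) : rfield (fun phi : V -> R => S \subset closed_edges phi).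
  exact: (@rfield_closed_edges (fun B => S \subset B)).
have cge0 (S : {set V * V}) : 0 <= 15 ^- (19 * l) * 14 ^+ #|S| :> R.
  by rewrite mulr_ge0 ?invr_ge0 ?exprn_ge0.
have nterm S : nnm (term S).
  by apply: nnmM; [apply: nnm_cst; rewrite lee_fin|exact: nnm_gint].
pose F phi := (\sum_x \sum_(p in simple_paths x) \sum_(S : {set V * V} | S \subset [set e in path_edges x p]%SET) term S phi)%E.
have nF : nnm F by do 3 (apply: nnm_sum => ? _).
apply: (@le_trans _ _ (tint F)).
  apply: tint_le => //; first by apply: nnm_gint => //; apply: rfield_not; exact: rfield_closed_edges.
  move=> phi.
  have -> : F phi = ((\sum_x \sum_(p in simple_paths x) path_weight x p phi) * gweight w phi)%:E.
    rewrite /F mulr_suml -sumEFin; apply: eq_bigr => x _.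
    rewrite mulr_suml -sumEFin; apply: eq_bigr => p _.
    rewrite /path_weight mulr_sumr mulr_suml -sumEFin; apply: eq_bigr => S _.
    by rewrite /term -EFinM !mulrA.
  rewrite lee_fin ler_wpM2r ?gweight_ge0//.
  case: (boolP (good_set l (closed_edges phi))) => /= [_|/not_good_path_weight//].
  by do 2 (apply: sumr_ge0 => ? _); exact: path_weight_ge0.
rewrite /tint /F iint_sum; last by move=> x _; do 2 (apply: nnm_sum => ? _).
have Z0 : (0 <= gint w (fun _ : V -> R => true))%E by apply: iint_ge0 => phi; rewrite lee_fin mulr_ge0// gweight_ge0.
have ninetnth : 0 <= (15 ^- (19 * l)) :> R by rewrite invr_ge0 exprn_ge0.
apply: (@le_trans _ _ (\sum_x \sum_(p in simple_paths x) (15 ^- (19 * l) * (1 + 14 / 8) ^+ (20 * l))%:E * gint w (fun _ : V -> R => true))%E).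
  apply: lee_sum => x _; rewrite iint_sum; last by move=> p _; apply: nnm_sum.
  apply: lee_sum => p; rewrite inE => /andP[xp up]; rewrite iint_sum//.
  have cE : #|[set e in path_edges x p]%SET| = (20 * l)%N.
    by rewrite cardsE (card_uniqP (uniq_path_edges up)) size_pairmap size_tuple.
  rewrite -{2}cE -sum_subset_expr mulr_sumr -sumEFin ge0_sume_distrl; last first.
    by move=> S _; rewrite lee_fin mulr_ge0// exprn_ge0// divr_ge0.
  apply: lee_sum => S SE.
  have SE' : S \subset tedge n.
    apply: (fintype.subset_trans SE); apply/fintype.subsetP => e; rewrite inE; exact: path_edges_tedge.
  rewrite iintZ//; last exact: nnm_gint.
  apply: (@le_trans _ _ ((15 ^- (19 * l) * 14 ^+ #|S|)%:E * (((1 / 8) ^+ #|S|)%:E * gint w (fun _ : V -> R => true)))%E).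
    by rewrite lee_wpmul2l ?lee_fin//; exact: closed_prob.
  by rewrite muleA -EFinM -mulrA -exprMn mulrA mulr1.
have nm (c : R) : 0 <= c -> (\sum_x \sum_(p in simple_paths x) c%:E * gint w (fun _ : V -> R => true) =
  ((\sum_x #|simple_paths x|%:R) * c)%:E * gint w (fun _ : V -> R => true))%E.
  move=> c0; rewrite mulr_suml -sumEFin ge0_sume_distrl; last first.
    by move=> x _; rewrite lee_fin mulr_ge0.
  apply: eq_bigr => x _; rewrite mulr_natl.
  have -> : c *+ #|simple_paths x| = \sum_(p in simple_paths x) c by rewrite sumr_const.
  by rewrite -sumEFin ge0_sume_distrl.
have c0 : 0 <= 15 ^- (19 * l) * (1 + 14 / 8) ^+ (20 * l) :> R.
  by rewrite mulr_ge0// exprn_ge0// addr_ge0// divr_ge0.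
rewrite nm//; apply: lee_wpmul2r => //; rewrite lee_fin.
apply: (@le_trans _ _ ((#|{: V}|%:R * 4 ^+ (20 * l)) * (15 ^- (19 * l) * (1 + 14 / 8) ^+ (20 * l)))).
  apply: ler_wpM2r => //.
  rewrite -sum1_card natr_sum mulr_suml; apply: ler_sum => x _; rewrite mul1r -natrX ler_nat.
  apply: leq_trans (card_paths x (20 * l)); apply/subset_leq_card/fintype.subsetP => p.
  by rewrite !inE => /andP[].
rewrite -mulrA ler_wpM2l// !exprM -exprVn -!exprMn lerXn2r ?nnegrE//.
have -> : 4 ^+ 20 * ((15 ^+ 19)^-1 * (1 + 14 / 8) ^+ 20) = (11 / 15) ^+ 19 * 11 :> R.
  have -> : (1 + 14 / 8) = 11 / 4 :> R by field.
  rewrite mulrCA -exprMn (_ : 4 * (11 / 4) = 11 :> R); last by field.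
  by rewrite (exprSr 11 19) mulrA -exprVn -exprMn [15^-1 * _]mulrC.
(* Repeated squaring bounds (11/15)^16 numerically. *)
have sq k (a b : R) : (11 / 15) ^+ k <= a -> a * a <= b -> (11 / 15) ^+ (k + k) <= b.
  move=> ha; apply: le_trans; rewrite exprD ler_pM ?exprn_ge0 ?divr_ge0//.
have x2 : (11 / 15) ^+ 2 <= 54 / 100 :> R by rewrite expr2; lra.
have x4 : (11 / 15) ^+ 4 <= 30 / 100 :> R by apply: (sq 2%N _ _ x2); lra.
have x8 : (11 / 15) ^+ 8 <= 9 / 100 :> R by apply: (sq 4%N _ _ x4); lra.
have x16 : (11 / 15) ^+ 16 <= 81 / 10000 :> R by apply: (sq 8%N _ _ x8); lra.
have x16' : 0 <= (11 / 15) ^+ 16 :> R by rewrite exprn_ge0 ?divr_ge0.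
have -> : (11 / 15) ^+ 19 = (11 / 15) ^+ 16 * ((11 / 15) * ((11 / 15) * (11 / 15))) :> R.
  by rewrite -expr2 -exprS -exprD.
lra.
Qed.

End Percolation.

(** * Lower bounds by integration over a small box *)

Section BoxBound.
Set Implicit Arguments. Unset Strict Implicit. Unset Printing Implicit Defensive.
Context {R : realType}.
Variable n : nat.
Local Notation V := (tvert n).

Lemma iint_box_ge (s : seq V) (f : (V -> R) -> \bar R) (phi g : V -> R) (k c : R) :
  nnm f -> 0 <= c -> 0 <= k ->
  (forall psi : V -> R, (forall u, `|psi u - g u| <= k) -> (c%:E <= f psi)%E) ->
  (forall u, u \notin s -> `|phi u - g u| <= k) ->
  ((c * (2 * k) ^+ size s)%:E <= iint s f phi)%E.
Proof.
move=> nf c0 k0 hf; elim: s phi => [|v s IH] phi hphi /=.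
  by rewrite expr0 mulr1; apply: hf => u; exact: hphi.
pose D : set (measurableTypeR R) := `[g v - k, g v + k]%classic.
have mD : measurable D by exact: measurable_itv.
have nfi := measurable_iint_slice v s phi nf.
apply: (@le_trans _ _ (\int[lebesgue_measure]_(x in D) iint s f (update phi v x))%E); last first.
  by apply: ge0_subset_integral => // x _; apply: iint_ge0; case: nf.
apply: (@le_trans _ _ (\int[lebesgue_measure]_(x in D) (c * (2 * k) ^+ size s)%:E)%E).
  rewrite integral_cst// /D /= lebesgue_measure_itv/= lte_fin.
  case: ifP => h.
    by rewrite -EFinD -EFinM lee_fin exprSr mulrA ler_wpM2l ?mulr_ge0 ?exprn_ge0 ?mulr_ge0//; lra.
  have -> : k = 0 by lra.
  by rewrite mulr0 exprS mul0r mulr0 mule0.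
apply: ge0_le_integral => //.
- by move=> x _; rewrite lee_fin !mulr_ge0 ?exprn_ge0 ?mulr_ge0.
- exact: measurable_funS nfi.
move=> x; rewrite /D/= in_itv/= => xD; apply: IH => u us; rewrite /update.
case: eqP => [->|/eqP uv]; first by rewrite ler_norml; lra.
by apply: hphi; rewrite inE negb_or uv.
Qed.

End BoxBound.

(** * Finiteness of the partition function *)

Section Tree.
Set Implicit Arguments. Unset Strict Implicit. Unset Printing Implicit Defensive.
Local Notation coord := Defs.coord.
Local Notation tsize := Defs.tsize.
Context {R : realType}.
Variable n : nat.
Local Notation V := (tvert n).

Lemma coord_descent (a : 'I_(tsize n)) : (0 < `|coord a|)%N ->
  exists b, cadj a b /\ (`|coord b| < `|coord a|)%N.
Proof.
have la := ltn_ord a; rewrite /coord => a0.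
have [h|h|h] := ltngtP a n.-1; last by rewrite h subrr in a0.
- have lb : (a.+1 < tsize n)%N by rewrite /tsize; move: (nat_of_ord a) h {la a0} => i h; rewrite -addnn; lia.
  exists (Ordinal lb); rewrite /cadj /= (modn_small lb) eqxx; split => //.
  by rewrite /=; move: (nat_of_ord a) h {a0 la lb} => i h; lia.
- have lb : (a.-1 < tsize n)%N by move: (nat_of_ord a) la {h a0} => i la; lia.
  have a1 : a.-1.+1 = a by apply: prednK; lia.
  exists (Ordinal lb); rewrite /cadj /= a1 (modn_small la) eqxx orbT; split => //.
  by move: (nat_of_ord a) h {a0 la lb} => i h; lia.
Qed.

Lemma parent_exists (u : V) : u != origin n -> exists p, tadj u p && (nrm p < nrm u)%N.
Proof.
move=> u0.
have : (0 < `|coord u.1|)%N || (0 < `|coord u.2|)%N.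
  apply: contraNT u0; rewrite negb_or -!leqNgt !leqn0 => /andP[/eqP h1 /eqP h2].
  have hn : (n.-1 < (n.-1).*2.+2)%N by rewrite -addnn; lia.
  case: u h1 h2 => i j; rewrite /coord /= => h1 h2.
  by apply/eqP; congr pair; apply: val_inj; rewrite /= inordK//; lia.
case/orP => /coord_descent[b [ab bl]].
- exists (b, u.2); rewrite /tadj /nrm /= eqxx ab orbT /=; lia.
- exists (u.1, b); rewrite /tadj /nrm /= eqxx ab /=; lia.
Qed.

(** Defines a spanning tree rooted at the origin along which the norm decreases; the root has no
    smaller neighbour and is its own parent by default. *)
Definition parent (u : V) : V := odflt u [pick p | tadj u p && (nrm p < nrm u)%N].

Lemma parentP u : u != origin n -> tadj u (parent u) /\ (nrm (parent u) < nrm u)%N.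
Proof.
move=> /parent_exists[p hp]; rewrite /parent; case: pickP => [q /andP[]//|/(_ p)].
by rewrite hp.
Qed.

(** The endpoint of larger norm is the child, so a tree edge determines it. *)
Lemma parent_edge_inj u v : u != origin n -> v != origin n ->
  ed u (parent u) = ed v (parent v) -> u = v.
Proof.
move=> /parentP[_ hu] /parentP[_ hv]; rewrite /ed.
by case: ifP => _; case: ifP => _ [] // h1 h2; move: hu hv; rewrite ?h1 ?h2 -?h1 -?h2; lia.
Qed.

Variable w : R -> R.
Hypothesis w_ge0 : forall x, 0 <= w x.
Hypothesis mw : measurable_fun setT w.
Hypothesis w_sym : forall x, w (- x) = w x.
Variable M : R.
Hypothesis M1 : 1 <= M.
Hypothesis wM : forall x, w x <= M.
Hypothesis w_fin : (\int[lebesgue_measure]_x (w x)%:E < +oo)%E.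

Lemma w_ed x y (phi : V -> R) : w (phi (ed x y).1 - phi (ed x y).2) = w (phi x - phi y).
Proof. by rewrite /ed; case: ifP => //= _; rewrite -w_sym opprB. Qed.

(** Every edge outside the tree costs a factor at most M; as M is at least 1, their number may be
    replaced by that of all edges. *)
Lemma gweight_le_tree (phi : V -> R) :
  gweight w phi <= M ^+ #|tedge n| * \prod_(u <- free_verts n) w (phi u - phi (parent u)).
Proof.
have uF : uniq (free_verts n) by rewrite filter_uniq// enum_uniq.
have -> : \prod_(u <- free_verts n) w (phi u - phi (parent u)) =
  \prod_(e in [set ed u (parent u) | u in free_verts n]%SET) w (phi e.1 - phi e.2).
  rewrite big_imset/=; last first.
    by move=> u v; rewrite !mem_free_verts; exact: parent_edge_inj.
  rewrite big_uniq//=; apply: eq_bigr => u _; by rewrite w_ed.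
set T := [set ed u (parent u) | u in free_verts n]%SET.
have TE : T \subset tedge n.
  apply/fintype.subsetP => e /imsetP[u]; rewrite mem_free_verts => /parentP[h _] ->.
  exact: ed_tedge.
have -> : gweight w phi = (\prod_(e in tedge n :\: T) w (phi e.1 - phi e.2)) * \prod_(e in T) w (phi e.1 - phi e.2).
  rewrite /gweight (big_setID T)/= mulrC (finset.setIidPr TE)//.
apply: ler_wpM2r; first by apply: prodr_ge0.
apply: (@le_trans _ _ (\prod_(e in tedge n :\: T) M)).
  by apply: ler_prod => e _; rewrite w_ge0 wM.
rewrite prodr_const ler_weXn2l//; exact/subset_leq_card/subsetDl.
Qed.

Lemma rfield_tree (s : seq V) : rfield (fun phi : V -> R => \prod_(u <- s) w (phi u - phi (parent u))).
Proof.
apply: rfield_prod => u _; apply: (rfield_comp (h := w)) => //.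
by apply: rfieldB; exact: rfield_coord.
Qed.

(** The vertices are integrated out from the leaves inwards: by translation invariance each
    contributes the integral of [w], whatever the value at its parent. *)
Lemma tree_iint (s : seq V) (phi : V -> R) : uniq s -> origin n \notin s ->
  pairwise (fun u v => nrm u <= nrm v)%N s ->
  iint s (fun psi => (\prod_(u <- s) w (psi u - psi (parent u)))%:E) phi =
  ((fine (\int[lebesgue_measure]_x (w x)%:E)%E) ^+ size s)%:E.
Proof.
set W := fine _.
have WE : (\int[lebesgue_measure]_x (w x)%:E)%E = W%:E.
  by rewrite fineK// ge0_fin_numE// integral_ge0// => x _; rewrite lee_fin.
have W0 : 0 <= W by rewrite fine_ge0// integral_ge0// => x _; rewrite lee_fin.
elim/last_ind: s phi => [|s v IH] phi; first by rewrite /= big_nil expr0.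
rewrite rcons_uniq mem_rcons inE negb_or pairwise_rcons => /andP[vs us] /andP[v0 os] /andP[/allP hv ps].
rewrite -cats1 iint_cat size_cat/= addn1 exprSr.
transitivity (iint s (fun psi => (W%:E * (\prod_(u <- s) w (psi u - psi (parent u)))%:E)%E) phi).
  apply: eq_iint => psi /=.
  (* The last vertex [v] has the largest norm in the list, so it is the parent of no vertex there
     and only its own factor contains x. *)
  have e x : \prod_(u <- s ++ [:: v]) w (update psi v x u - update psi v x (parent u)) =
     (\prod_(u <- s) w (psi u - psi (parent u))) * w (x - psi (parent v)).
    rewrite big_cat big_seq1 /update eqxx.
    have [_ hp] : tadj v (parent v) /\ (nrm (parent v) < nrm v)%N by apply: parentP; rewrite eq_sym.
    have -> : (parent v == v) = false by apply/eqP => h; move: hp; rewrite h ltnn.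
    congr (_ * _); rewrite !big_seq; apply: eq_bigr => u us'.
    have -> : (u == v) = false by apply/eqP => h; move: vs; rewrite -h us'.
    have u0 : u != origin n by apply/eqP => h; move: os; rewrite -h us'.
    have -> // : (parent u == v) = false.
    by apply/eqP => h; have [_] := parentP u0; have := hv u us'; rewrite h; lia.
  under eq_integral do rewrite e EFinM.
  rewrite ge0_integralZl_EFin//; last 3 first.
  - by move=> x _; rewrite lee_fin.
  - by apply/measurable_EFinP; apply: (measurableT_comp mw); exact: measurable_funB.
  - exact: prodr_ge0.
  rewrite (lebesgue_integral_shift (f := fun x => (w x)%:E))//.
  - by rewrite WE muleC.
  - exact/measurable_EFinP.
rewrite iintZ// ?IH//; last first.
  by apply: nnm_rfield; [exact: rfield_tree|move=> psi; exact: prodr_ge0].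
by rewrite -EFinM mulrC.
Qed.

Lemma gint_fin : (gint w (fun _ : V -> R => true) < +oo)%E.
Proof.
pose s := sort (fun u v : V => nrm u <= nrm v)%N (free_verts n).
have uF : uniq (free_verts n) by rewrite filter_uniq// enum_uniq.
have MN0 : 0 <= M ^+ #|tedge n| by rewrite exprn_ge0// (le_trans ler01 M1).
have nT : nnm (fun phi : V -> R => (\prod_(u <- s) w (phi u - phi (parent u)))%:E).
  by apply: nnm_rfield; [exact: rfield_tree|move=> psi; exact: prodr_ge0].
apply: (@le_lt_trans _ _ (tint (fun phi : V -> R => (M ^+ #|tedge n|)%:E * (\prod_(u <- s) w (phi u - phi (parent u)))%:E)%E)).
  apply: tint_le.
  - by apply: nnm_gint => //; exact: rfield_cst.
  - by apply: nnmM => //; apply: nnm_cst; rewrite lee_fin.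
  move=> phi; rewrite mul1r -EFinM lee_fin.
  have -> : \prod_(u <- s) w (phi u - phi (parent u)) = \prod_(u <- free_verts n) w (phi u - phi (parent u)).
    by apply: perm_big; rewrite perm_sort.
  exact: gweight_le_tree.
rewrite /tint iintZ// -/(free_verts n) (@iint_perm _ _ _ s)//; last by rewrite perm_sym perm_sort.
rewrite tree_iint ?sort_uniq//.
- by rewrite -EFinM ltry.
- by rewrite mem_sort mem_free_verts eqxx.
rewrite -sorted_pairwise; last by move=> u v z; apply: leq_trans.
by apply: sort_sorted => u v; exact: leq_total.
Qed.

End Tree.

(** * The cutoff *)

Section SecondDifference.
Set Implicit Arguments. Unset Strict Implicit. Unset Printing Implicit Defensive.
Context {R : realType}.
Implicit Types (g : R -> R).

Lemma continuous_bounded_itv g (a b : R) : a <= b -> continuous g ->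
  exists M, 0 <= M /\ forall x, a <= x <= b -> `|g x| <= M.
Proof.
move=> ab cg.
have cn : {within `[a, b], continuous (fun x => `|g x|)}.
  apply: continuous_subspaceT => x; apply: continuous_comp; first exact: cg.
  exact: norm_continuous.
have [c _ hc] := EVT_max ab cn.
by exists `|g c|; split => // x xab; apply: hc; rewrite in_itv.
Qed.

Lemma MVT_derivable g (a b : R) : (forall x, derivable g x 1) -> a <= b ->
  exists2 c, a <= c <= b & g b - g a = derive1 g c * (b - a).
Proof.
move=> dg; rewrite le_eqVlt => /predU1P[->|ab].
  by exists b; rewrite ?lexx// !subrr mulr0.
have [||c] := @MVT R g (derive1 g) a b ab.
- move=> x _; rewrite derive1E; exact/derivableP.
- apply: continuous_subspaceT => x; exact/differentiable_continuous/derivable1_diffP.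
by rewrite in_itv/= => /andP[ac cb] ->; exists c => //; rewrite !ltW.
Qed.

(** Three uses of the mean value theorem: the two first differences give g' at points at most 2 d
    apart, and g'' is bounded on [-1, 1]. *)
Lemma second_difference_le g : (forall x, derivable g x 1) ->
  (forall x, derivable (derive1 g) x 1) -> continuous (derive1n 2 g) ->
  exists M, 0 <= M /\ forall x d, -1 <= x - d -> x - d <= 1 -> -1 <= x + d -> x + d <= 1 ->
    g (x + d) + g (x - d) - 2 * g x <= M * d ^+ 2.
Proof.
move=> dg ddg cg.
have m11 : -1 <= 1 :> R by lra.
have [M [M0 hM]] := continuous_bounded_itv m11 cg.
exists (2 * M); split; first by rewrite mulr_ge0.
suff pos x d : 0 <= d -> -1 <= x - d -> x + d <= 1 ->
    g (x + d) + g (x - d) - 2 * g x <= 2 * M * d ^+ 2.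
  move=> x d h1 h2 h3 h4; have [d0|d0] := leP 0 d; first exact: pos.
  have := pos x (- d); rewrite opprK sqrrN; move: h1 h2 h3 h4 => h1 h2 h3 h4 h.
  rewrite [_ + g (x - d)]addrC; apply: h; lra.
move=> d0 h1 h2.
have [a ha ea] := @MVT_derivable g x (x + d) dg (ltac:(lra)).
have [b hb eb] := @MVT_derivable g (x - d) x dg (ltac:(lra)).
have [c hc ec] := @MVT_derivable (derive1 g) b a ddg (ltac:(lra)).
have hMc : `|derive1 (derive1 g) c| <= M by apply: hM; lra.
have -> : g (x + d) + g (x - d) - 2 * g x = (derive1 g a - derive1 g b) * d.
  have e' : derive1 g a * d = g (x + d) - g x by rewrite ea; ring.
  have e : derive1 g b * d = g x - g (x - d) by rewrite eb; ring.
  rewrite mulrBl e' e; ring.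
rewrite ec expr2 mulrA ler_wpM2r//.
apply: (@le_trans _ _ (M * (a - b))).
  rewrite ler_wpM2r//; first by lra.
  by move: hMc; rewrite ler_norml => /andP[].
have -> : 2 * M * d = M * (2 * d) by ring.
by rewrite ler_wpM2l//; lra.
Qed.

End SecondDifference.

(** * The cutoff [zeta] and its behaviour under shifts *)

Section Cutoff.
Set Implicit Arguments. Unset Strict Implicit. Unset Printing Implicit Defensive.
Context {R : realType}.
Variables (a0 b0 : R).
Hypothesis b0_gt0 : 0 < b0.
Hypothesis a0_ge0 : 0 <= a0.

(** Distance to the interval [-a0, a0] in units of b0, so that [zeta] is 1 on the interval and 0
    beyond a0 + b0. *)
Definition excess (x : R) : R := Num.max 0 (`|x| - a0) / b0.
Definition psi (x : R) : R := Num.max 0 (1 - excess x ^+ 2).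
Definition zeta (x : R) : R := psi x ^+ 2.
Let beta := b0^-1.

Lemma excess_ge0 x : 0 <= excess x.
Proof. by rewrite /excess divr_ge0 ?(ltW b0_gt0)// le_max lexx. Qed.

Lemma psi01 x : 0 <= psi x <= 1.
Proof. by rewrite /psi le_max lexx /= ge_max ler01 /= gerBl sqr_ge0. Qed.

Lemma zeta01 x : 0 <= zeta x <= 1.
Proof.
have /andP[p0 p1] := psi01 x.
by rewrite /zeta sqr_ge0/= expr_le1.
Qed.

Lemma zeta_inside x : `|x| <= a0 -> zeta x = 1.
Proof.
move=> h; have h' : `|x| - a0 <= 0 by rewrite subr_le0.
by rewrite /zeta /psi /excess (max_l h') mul0r expr0n/= subr0 (max_r ler01) expr1n.
Qed.

Lemma zeta_outside x : a0 + b0 <= `|x| -> zeta x = 0.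
Proof.
move=> h; have h' : 0 <= `|x| - a0 by rewrite subr_ge0 (le_trans _ h)// lerDl ltW.
have h1 : 1 <= excess x by rewrite /excess (max_r h') ler_pdivlMr// mul1r lerBrDl.
have h2 : 1 - excess x ^+ 2 <= 0 by rewrite subr_le0 exprn_ege1.
by rewrite /zeta /psi (max_l h2) expr0n.
Qed.

(** Here q is the point of [-a0, a0] nearest to x. *)
Lemma excess_dist x : exists2 q, `|q| <= a0 & excess x ^+ 2 = (beta * (x - q)) ^+ 2.
Proof.
rewrite /excess -/beta; have [h|h] := leP `|x| a0.
  by exists x => //; rewrite max_l ?subr_le0// subrr mul0r mulr0.
rewrite max_r ?subr_ge0 ?(ltW h)//; have [x0|x0] := leP 0 x.
  exists a0; first by rewrite ger0_norm.
  by rewrite ger0_norm// mulrC.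
exists (- a0); first by rewrite normrN ger0_norm.
by rewrite ltr0_norm// -sqrrN; congr (_ ^+ 2); rewrite mulrC; ring.
Qed.

Lemma excess_le_dist x q : `|q| <= a0 -> excess x ^+ 2 <= (beta * (x - q)) ^+ 2.
Proof.
move=> hq; have b0' : 0 <= beta by rewrite invr_ge0 ltW.
rewrite -[leRHS]real_normK ?num_real// lerXn2r ?nnegrE ?excess_ge0//.
rewrite normrM (ger0_norm b0') mulrC ler_wpM2r// ge_max normr_ge0 /=.
by rewrite lerBlDr -{1}(subrK q x) (le_trans (ler_normD _ _))// lerD2l.
Qed.

(* The squared distance to the convex set [-a0, a0] is semiconcave. *)
Lemma psi_semiconvex x d : 2 * psi x - 2 * (beta * d) ^+ 2 <= psi (x + d) + psi (x - d).
Proof.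
(* The nearest point of x is a competitor for x + d and x - d as well, which leaves the
   parallelogram identity. *)
have [q hq eq] := excess_dist x.
have h1 := excess_le_dist (x + d) hq; have h2 := excess_le_dist (x - d) hq.
have s : excess (x + d) ^+ 2 + excess (x - d) ^+ 2 <= 2 * excess x ^+ 2 + 2 * (beta * d) ^+ 2.
  apply: (le_trans (lerD h1 h2)); rewrite eq -subr_ge0.
  by rewrite [X in 0 <= X](_ : _ = 0)//; ring.
have p1 : 1 - excess (x + d) ^+ 2 <= psi (x + d) by rewrite /psi le_max lexx orbT.
have p2 : 1 - excess (x - d) ^+ 2 <= psi (x - d) by rewrite /psi le_max lexx orbT.
have /andP[p30 _] := psi01 (x + d); have /andP[p40 _] := psi01 (x - d).
have bd0 : 0 <= (beta * d) ^+ 2 by rewrite sqr_ge0.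
have [h|h] := leP (1 - excess x ^+ 2) 0.
  by rewrite {1}/psi max_l//; lra.
by rewrite {1}/psi max_r; lra.
Qed.

(** The function 1 - e^2 has slope at most 2 for e in [0, 1], and [excess] is Lipschitz with
    constant [beta]. *)
Lemma psi_lipschitz x y : `|psi x - psi y| <= 2 * beta * `|x - y|.
Proof.
have b0' : 0 <= beta by rewrite invr_ge0 ltW.
suff one u v : psi u - psi v <= 2 * beta * `|u - v|.
  by rewrite ler_norml one andbT lerNl opprB distrC one.
have /andP[pv0 pv1] := psi01 v.
have rhs0 : 0 <= 2 * beta * `|u - v| by rewrite !mulr_ge0.
rewrite {1}/psi; have [h|h] := leP (1 - excess u ^+ 2) 0; first by lra.
have u1 : excess u < 1.
  by rewrite -(@expr_lt1 _ 2)// ?excess_ge0//; lra.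
have u0 := excess_ge0 u; have v0 := excess_ge0 v.
have ex : excess v - excess u <= beta * `|u - v|.
  rewrite /excess -mulrBl mulrC ler_wpM2l//.
  have t : `|v| <= `|u| + `|u - v|.
    by rewrite -lerBlDl distrC (le_trans _ (lerB_dist v u)).
  rewrite lerBlDr ge_max; apply/andP; split; first by rewrite addr_ge0// le_max lexx.
  have m : `|u| - a0 <= Num.max 0 (`|u| - a0) by rewrite le_max lexx orbT.
  lra.
have pv : 1 - excess v ^+ 2 <= psi v by rewrite /psi le_max lexx orbT.
have [uv|uv] := leP (excess v) (excess u).
  have : excess v ^+ 2 <= excess u ^+ 2 by rewrite lerXn2r.
  lra.
have [v1|v1] := leP (excess v) 1.
  have : (excess v - excess u) * (excess v + excess u) <= beta * `|u - v| * 2.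
    by apply: ler_pM; lra.
  have -> : (excess v - excess u) * (excess v + excess u) = excess v ^+ 2 - excess u ^+ 2 by ring.
  lra.
have : (1 - excess u) * (1 + excess u) <= beta * `|u - v| * 2.
  by apply: ler_pM; lra.
have -> : (1 - excess u) * (1 + excess u) = 1 - excess u ^+ 2 by ring.
lra.
Qed.

Lemma measurable_zeta : measurable_fun setT zeta.
Proof.
apply: measurable_funX; apply: measurable_maxr; first exact: measurable_cst.
apply: measurable_funB => //; apply: measurable_funX; apply: measurable_funM => //.
apply: measurable_maxr; first exact: measurable_cst.
by apply: measurable_funB => //; exact: normr_measurable.
Qed.

(* The extra 14 (beta eta)^2 (1 - zeta) pays for the second-order loss in [open_factor] where zeta is
   small. *)
Definition zeta' (eta x : R) : R := 1 - (1 - 14 * (beta * eta) ^+ 2) * (1 - zeta x).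

(** Lets a loss factor 1 - u be absorbed into an exponential. *)
Lemma expR_1B (u : R) : 0 <= u <= 1 / 2 -> 1 <= expR (2 * u) * (1 - u).
Proof.
move=> hu; apply: (@le_trans _ _ ((1 + 2 * u) * (1 - u))); first by nra.
by apply: ler_wpM2r; [lra|exact: expR_ge1Dx].
Qed.

Variable eta : R.
Hypothesis eta0 : 0 <= eta.
Hypothesis eta_small : beta * eta <= 1 / 8.

Let be2 : 0 <= (beta * eta) ^+ 2 <= 1 / 64.
Proof.
have b0' : 0 <= beta by rewrite invr_ge0 ltW.
rewrite sqr_ge0/= (_ : 1 / 64 = (1 / 8) ^+ 2 :> R); last by rewrite expr2; field.
by rewrite lerXn2r ?nnegrE ?mulr_ge0// divr_ge0.
Qed.

Lemma zeta'01 x : 0 <= zeta' eta x <= 1.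
Proof.
have /andP[z0 z1] := zeta01 x; have /andP[h0 h1] := be2.
rewrite /zeta'; set b := (beta * eta) ^+ 2 in h0 h1 *; set z := zeta x in z0 z1 *; nra.
Qed.

(** The factor 1 - zeta' is (1 - 14 b)(1 - zeta) with b = (beta eta)^2, so the loss is at most
    exp(56 b); the constant 96 is the one that [open_factor] requires. *)
Lemma closed_factor x : (1 - zeta x) ^+ 2 <=
  expR (96 * (beta * eta) ^+ 2) * (1 - zeta' eta x) ^+ 2.
Proof.
have /andP[h0 h1] := be2.
have -> : 1 - zeta' eta x = (1 - 14 * (beta * eta) ^+ 2) * (1 - zeta x) by rewrite /zeta'; ring.
set b := (beta * eta) ^+ 2 in h0 h1 *.
rewrite exprMn mulrA ler_peMl ?sqr_ge0//.
have u1 : 1 <= expR (2 * (14 * b)) * (1 - 14 * b) by apply: expR_1B; lra.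
apply: (@le_trans _ _ ((expR (2 * (14 * b)) * (1 - 14 * b)) ^+ 2)); first exact: exprn_ege1.
by rewrite exprMn ler_wpM2r ?sqr_ge0// -expRM_natl ler_expR; lra.
Qed.

(** With p, q, r the values of [psi] at x, x + d, x - d and b = (beta eta)^2, semiconvexity and the
    Lipschitz bound give q r >= p^2 - 6 b. For large p this is a multiplicative loss; for small p
    the extra mass in zeta' compensates it. *)
Lemma open_factor x d : `|d| <= eta -> zeta x ^+ 2 <=
  expR (96 * (beta * eta) ^+ 2) * (zeta' eta (x + d) * zeta' eta (x - d)).
Proof.
move=> hd; have /andP[h0 h1] := be2.
have b0' : 0 <= beta by rewrite invr_ge0 ltW.
have hbd : (beta * d) ^+ 2 <= (beta * eta) ^+ 2.
  rewrite -[leLHS]real_normK ?num_real// lerXn2r ?nnegrE ?mulr_ge0//.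
  by rewrite normrM (ger0_norm b0') ler_wpM2l.
have bd0 : 0 <= (beta * d) ^+ 2 by rewrite sqr_ge0.
have sc := psi_semiconvex x d.
have lp : `|psi (x + d) - psi (x - d)| <= 4 * (beta * `|d|).
  apply: (le_trans (psi_lipschitz _ _)).
  have -> : x + d - (x - d) = 2 * d by ring.
  by rewrite normrM ger0_norm//; lra.
have lp2 : (psi (x + d) - psi (x - d)) ^+ 2 <= 16 * (beta * d) ^+ 2.
  rewrite -[leLHS]real_normK ?num_real//.
  apply: (@le_trans _ _ ((4 * (beta * `|d|)) ^+ 2)).
    by rewrite lerXn2r ?nnegrE ?mulr_ge0.
  by rewrite !exprMn real_normK ?num_real//; lra.
have bd1 : beta * `|d| <= 1 / 8 by apply: le_trans eta_small; rewrite ler_wpM2l.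
have l1 : psi (x + d) <= psi x + 1 / 4.
  have := psi_lipschitz (x + d) x; have -> : x + d - x = d by ring.
  rewrite ler_norml => /andP[_]; lra.
have l2 : psi (x - d) <= psi x + 1 / 4.
  have := psi_lipschitz (x - d) x; have -> : x - d - x = - d by ring.
  rewrite normrN ler_norml => /andP[_]; lra.
have /andP[p0 p1] := psi01 x; have /andP[q0 q1] := psi01 (x + d); have /andP[r0 r1] := psi01 (x - d).
rewrite /zeta' /zeta.
set b := (beta * eta) ^+ 2 in h0 h1 hbd *; set c := (beta * d) ^+ 2 in hbd sc lp2 bd0.
set p := psi x in sc l1 l2 p0 p1 *; set q := psi (x + d) in sc lp2 l1 q0 q1 *.
set r := psi (x - d) in sc lp2 l2 r0 r1 *.
(* From q r = ((q + r)^2 - (q - r)^2) / 4 the losses are 2 p c from semiconvexity and 4 c from the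
   Lipschitz bound, with p <= 1 and c <= b. *)
have qr : p ^+ 2 - 6 * b <= q * r.
  have s2 : 4 * p ^+ 2 - 8 * p * c <= (q + r) ^+ 2.
    have [pc|pc] := leP p c.
      apply: le_trans (sqr_ge0 _); have := mulr_ge0 p0 bd0.
      have : p * p <= p * c by rewrite ler_wpM2l.
      rewrite expr2; lra.
    apply: (@le_trans _ _ ((2 * p - 2 * c) ^+ 2)); last first.
      by apply: lerXn2r; rewrite ?nnegrE; lra.
    rewrite -subr_ge0 [X in 0 <= X](_ : _ = 4 * c ^+ 2); last by ring.
    by rewrite mulr_ge0 ?sqr_ge0.
  have pc1 : p * c <= c by rewrite ler_piMl.
  have -> : q * r = ((q + r) ^+ 2 - (q - r) ^+ 2) / 4 by field.
  lra.
have e1 : 1 - (1 - 14 * b) * (1 - q ^+ 2) = q ^+ 2 + 14 * b * (1 - q ^+ 2) by ring.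
have e2 : 1 - (1 - 14 * b) * (1 - r ^+ 2) = r ^+ 2 + 14 * b * (1 - r ^+ 2) by ring.
rewrite e1 e2.
have q2 : 0 <= 1 - q ^+ 2 by nra.
have r2 : 0 <= 1 - r ^+ 2 by nra.
have E1 : 1 <= expR (96 * b) by have := expR_ge1Dx (96 * b); lra.
(* If p >= 1/2 then 6 b <= 24 b p^2, so the loss is a factor 1 - 24 b, which squared costs exp(96
   b). *)
have [hp|hp] := leP (1 / 2) p.
  have u1 : 1 <= expR (2 * (24 * b)) * (1 - 24 * b) by apply: expR_1B; lra.
  have p2 : 1 / 4 <= p ^+ 2.
    rewrite (_ : 1 / 4 = (1 / 2) ^+ 2 :> R); last by rewrite expr2; field.
    by apply: lerXn2r; rewrite ?nnegrE; lra.
  have bp2 : b * (1 / 4) <= b * p ^+ 2 by rewrite ler_wpM2l.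
  have qrp : (1 - 24 * b) * p ^+ 2 <= q * r by lra.
  have k0 : 0 <= (1 - 24 * b) * p ^+ 2 by rewrite mulr_ge0 ?sqr_ge0//; lra.
  apply: (@le_trans _ _ (expR (96 * b) * (q * r) ^+ 2)); last first.
    rewrite ler_wpM2l ?expR_ge0// exprMn; apply: ler_pM; rewrite ?sqr_ge0//.
    - by rewrite lerDl !mulr_ge0.
    - by rewrite lerDl !mulr_ge0.
  apply: (@le_trans _ _ (expR (96 * b) * ((1 - 24 * b) * p ^+ 2) ^+ 2)); last first.
    by rewrite ler_wpM2l ?expR_ge0//; apply: lerXn2r; rewrite ?nnegrE// mulr_ge0.
  rewrite [((1 - 24 * b) * _) ^+ 2]exprMn mulrA ler_peMl ?sqr_ge0//.
  apply: (@le_trans _ _ ((expR (2 * (24 * b)) * (1 - 24 * b)) ^+ 2)); first exact: exprn_ege1.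
  by rewrite exprMn ler_wpM2r ?sqr_ge0// -expRM_natl ler_expR; lra.
apply: (@le_trans _ _ ((q ^+ 2 + 14 * b * (1 - q ^+ 2)) * (r ^+ 2 + 14 * b * (1 - r ^+ 2)))); last first.
  rewrite ler_peMl// mulr_ge0// addr_ge0 ?sqr_ge0// !mulr_ge0//.
(* If p < 1/2 then q, r <= 3/4, so the added mass is at least 14 (7/16) b, which exceeds 6 b;
   Cauchy-Schwarz then gives (q^2 + 6 b)(r^2 + 6 b) >= (q r + 6 b)^2 >= p^4. *)
have A1 : 6 * b <= 14 * b * (1 - q ^+ 2).
  have q34 : q ^+ 2 <= (3 / 4) ^+ 2 by apply: lerXn2r; rewrite ?nnegrE; lra.
  have : b * (7 / 16) <= b * (1 - q ^+ 2) by rewrite ler_wpM2l//; move: q34; rewrite expr2 [leRHS]expr2; lra.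
  lra.
have A2 : 6 * b <= 14 * b * (1 - r ^+ 2).
  have r34 : r ^+ 2 <= (3 / 4) ^+ 2 by apply: lerXn2r; rewrite ?nnegrE; lra.
  have : b * (7 / 16) <= b * (1 - r ^+ 2) by rewrite ler_wpM2l//; move: r34; rewrite expr2 [leRHS]expr2; lra.
  lra.
apply: (@le_trans _ _ ((q ^+ 2 + 6 * b) * (r ^+ 2 + 6 * b))); last first.
  by apply: ler_pM; rewrite ?addr_ge0 ?sqr_ge0 ?mulr_ge0// lerD2l.
apply: (@le_trans _ _ ((q * r + 6 * b) ^+ 2)); last first.
  rewrite -subr_ge0.
  have -> : (q ^+ 2 + 6 * b) * (r ^+ 2 + 6 * b) - (q * r + 6 * b) ^+ 2 = 6 * b * (q - r) ^+ 2 by ring.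
  by rewrite mulr_ge0 ?sqr_ge0// mulr_ge0.
have qr0 : 0 <= q * r by rewrite mulr_ge0.
by rewrite lerXn2r ?nnegrE ?sqr_ge0 ?addr_ge0 ?mulr_ge0//; lra.
Qed.

End Cutoff.

(** * Radial gradients and their energy *)

Section Counting.
Set Implicit Arguments. Unset Strict Implicit. Unset Printing Implicit Defensive.
Local Notation coord := Defs.coord.
Local Notation tsize := Defs.tsize.
Context {R : realType}.
Variable n : nat.
Local Notation V := (tvert n).

(** A vertex of norm r is determined by the absolute value of its first coordinate and two signs. *)
Lemma card_sphere r : (#|[set u : V | nrm u == r]%SET| <= 4 * r.+1)%N.
Proof.
pose f (m : nat) (b : bool) : 'I_(tsize n) := inord (if b then n.-1 + m else n.-1 - m)%N.
have fE (i : 'I_(tsize n)) : i = f `|coord i|%N (n.-1 <= i)%N.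
  apply: val_inj; rewrite /f /coord /=; have := ltn_ord i.
  move: (nat_of_ord i) => j; rewrite /tsize; move: (n.-1) => m lj.
  by rewrite inordK; case: (leqP m j); rewrite -?addnn in lj *; lia.
pose g (t : 'I_r.+1 * (bool * bool)) : V := (f t.1 t.2.1, f (r - t.1)%N t.2.2).
have -> : (4 * r.+1)%N = #|{: 'I_r.+1 * (bool * bool)}| by rewrite !card_prod card_ord card_bool mulnC.
rewrite -cardsT; apply: leq_trans (leq_imset_card g _).
apply/subset_leq_card/fintype.subsetP => -[i j]; rewrite inE /nrm /= => /eqP hr.
apply/imsetP; have hi : (`|coord i|%N < r.+1)%N by lia.
exists (Ordinal hi, (n.-1 <= i, n.-1 <= j)%N) => //.
rewrite /g /= {1}(fE i) {1}(fE j); congr (_, f _ _); lia.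
Qed.

(** Each edge is charged to its first endpoint, and at most four edges meet there. *)
Lemma sum_edges_le (F : nat -> R) : (forall r, 0 <= F r) ->
  \sum_(e in tedge n) F (nrm e.1) <= 4 * \sum_(u : V) F (nrm u).
Proof.
move=> F0.
apply: (@le_trans _ _ (\sum_(e : V * V | tadj e.1 e.2) F (nrm e.1))).
  rewrite big_mkcond [leRHS]big_mkcond; apply: ler_sum => e _.
  rewrite inE; case: (tadj e.1 e.2) => //=; case: ifP => //.
rewrite -(pair_big_dep xpredT (fun u v : V => tadj u v) (fun u _ => F (nrm u)))/=.
rewrite mulr_sumr; apply: ler_sum => u _; rewrite sumr_const -[F _ *+ _]mulr_natl ler_wpM2r// ler_nat.
by apply: leq_trans (degree_le4 u); apply/eq_leq/eq_card => v; rewrite !inE.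
Qed.

Lemma sum_radial_le (F : nat -> R) N : (forall r, 0 <= F r) -> (forall r, (N < r)%N -> F r = 0) ->
  \sum_(u : V) F (nrm u) <= \sum_(r < N.+1) (4 * r.+1)%:R * F r.
Proof.
move=> F0 FN.
apply: (@le_trans _ _ (\sum_(u : V) \sum_(r < N.+1) (nrm u == r)%:R * F r)).
  apply: ler_sum => u _; have [h|h] := leqP (nrm u) N.
    rewrite -ltnS in h; rewrite (bigD1 (Ordinal h))//= eqxx mul1r lerDl.
    by apply: sumr_ge0 => r _; rewrite mulr_ge0.
  by rewrite FN//; apply: sumr_ge0 => r _; rewrite mulr_ge0.
rewrite exchange_big/=; apply: ler_sum => r _; rewrite -mulr_suml ler_wpM2r//.
rewrite -natr_sum ler_nat; apply: leq_trans (card_sphere r).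
by rewrite -sum1_card big_mkcond [leqRHS]big_mkcond; apply: leq_sum => u _; rewrite inE; case: eqP.
Qed.

Lemma harmonic_le N : \sum_(r < N.+1) (r%:R : R)^-1 <= 1 + ln N%:R.
Proof.
(* The index r = 0 is harmless: both 0^-1 and ln 0 are 0 by convention. *)
elim: N => [|N IH]; first by rewrite big_ord_recr big_ord0/= add0r invr0 ln0// addr0.
rewrite big_ord_recr/=; case: N IH => [|N] IH.
  by rewrite !big_ord_recr big_ord0/= !add0r invr0 add0r invr1 ln1 addr0.
apply: (le_trans (lerD IH (lexx _))).
rewrite -addrA lerD2l -lerBrDl.
have p1 : 0 < (N.+1%:R : R) by rewrite ltr0n.
have p2 : 0 < (N.+2%:R : R) by rewrite ltr0n.
rewrite -lerN2 opprB -ln_div ?posrE//.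
have -> : (N.+1%:R / N.+2%:R : R) = 1 + (- N.+2%:R^-1).
  have e : N.+2%:R = N.+1%:R + 1 :> R by rewrite natr1.
  have nz : N.+1%:R + 1 != 0 :> R by rewrite -e; exact: lt0r_neq0.
  by rewrite e; move: (N.+1%:R : R) nz => x nz; field; exact: nz.
by apply: le_ln1Dx; rewrite ltrN2 invf_lt1// ltr1n.
Qed.

(** The gradient size of a log |x| on an annulus: in two dimensions such a profile climbs by a
    multiple of log(hi / lo) with energy of the same order. *)
Definition radial_grad (a lo : R) (hi : nat) (e : V * V) : R :=
  if (lo <= (nrm e.1)%:R) && (nrm e.1 <= hi)%N then a / (nrm e.1)%:R else 0.

Lemma radial_grad_ge0 a lo hi e : 0 <= a -> 0 <= radial_grad a lo hi e.
Proof. by move=> a0; rewrite /radial_grad; case: ifP => // _; rewrite divr_ge0. Qed.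

Lemma radial_grad_le a lo hi e : 0 <= a -> 0 < lo -> radial_grad a lo hi e <= a / lo.
Proof.
move=> a0 lo0; rewrite /radial_grad; case: ifP => [/andP[h _]|_]; last by rewrite divr_ge0// ltW.
by rewrite ler_wpM2l// lef_pV2 ?posrE// (lt_le_trans lo0).
Qed.

(** A sphere has at most 4 (r + 1) <= 8 r vertices with four edges each, so the energy is at most 32
    a^2 times a harmonic sum. *)
Lemma radial_energy_le a lo hi : 0 <= a -> 0 < lo ->
  \sum_(e in tedge n) radial_grad a lo hi e ^+ 2 <= 32 * a ^+ 2 * (1 + ln hi%:R).
Proof.
move=> a0 lo0.
pose F (r : nat) : R := if (lo <= r%:R) && (r <= hi)%N then a ^+ 2 / (r%:R ^+ 2) else 0.
have F0 r : 0 <= F r by rewrite /F; case: ifP => // _; rewrite divr_ge0 ?sqr_ge0.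
have FN r : (hi < r)%N -> F r = 0 by move=> h; rewrite /F leqNgt h andbF.
rewrite (eq_bigr (fun e => F (nrm e.1))); last first.
  by move=> e _; rewrite /radial_grad /F; case: ifP => _; rewrite ?expr0n// expr_div_n.
apply: (le_trans (sum_edges_le F0)).
apply: (@le_trans _ _ (4 * (\sum_(r < hi.+1) (8 * a ^+ 2) * (r%:R)^-1))); last first.
  rewrite -mulr_sumr.
  have -> : 32 * a ^+ 2 * (1 + ln hi%:R) = 4 * (8 * a ^+ 2 * (1 + ln hi%:R)) by ring.
  by rewrite !ler_wpM2l ?mulr_ge0 ?sqr_ge0// harmonic_le.
rewrite ler_wpM2l//; apply: (le_trans (sum_radial_le F0 FN)).
apply: ler_sum => r _; rewrite /F; case: ifP => [/andP[h _]|_]; last first.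
  by rewrite mulr0 !mulr_ge0 ?sqr_ge0 ?invr_ge0.
have rp : 0 < (r%:R : R) by rewrite (lt_le_trans lo0).
have r1 : (0 < r)%N by rewrite -(ltr0n R).
have -> : 8 * a ^+ 2 * (r%:R)^-1 = (8 * r%:R) * (a ^+ 2 / r%:R ^+ 2) by field; exact: lt0r_neq0.
rewrite ler_wpM2r ?divr_ge0 ?sqr_ge0// -natrM ler_nat; lia.
Qed.

End Counting.

(** * The shift inequality for the Gibbs weight *)

Section Shift.
Set Implicit Arguments. Unset Strict Implicit. Unset Printing Implicit Defensive.
Context {R : realType}.
Variables n l : nat.
Local Notation V := (tvert n).
Variable w : R -> R.
Hypothesis w_ge0 : forall x, 0 <= w x.
Hypothesis mw : measurable_fun setT w.
Variables (eps M : R).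
Hypothesis eps_gt0 : 0 < eps.
Hypothesis eps_half : eps <= 1 / 2.
Hypothesis M_ge0 : 0 <= M.
Hypothesis w_semi : forall x d, `|x - d| <= 1 -> `|x + d| <= 1 ->
  w x ^+ 2 <= expR (M * d ^+ 2) * (w (x + d) * w (x - d)).
Variable eta : V * V -> R.
Hypothesis eta_ge0 : forall e, 0 <= eta e.
Hypothesis eta_small : forall e, (eps / 2)^-1 * eta e <= 1 / 8.

Let a0 := 1 - eps.
Let b0 := eps / 2.
(** Loss per unit of eta^2: the first term comes from the cutoff, the second from the second
    difference of U. *)
Let Ce := 96 * b0^-1 ^+ 2 + M.

Let b0_gt0 : 0 < b0. Proof. by rewrite divr_gt0. Qed.
Let a0_ge0 : 0 <= a0. Proof. by rewrite subr_ge0 (le_trans eps_half)//; lra. Qed.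

Let z (e : V * V) := zeta a0 b0.
Let z' (e : V * V) := zeta' a0 b0 (eta e).

Lemma edge_factor_shift (B : {set V * V}) e x d :
  `|d| <= edge_cost eta B e ->
  edge_factor w z B e x ^+ 2 <= (if e \in tedge n then expR (Ce * eta e ^+ 2) else 1) *
    (edge_factor w z' B e (x + d) * edge_factor w z' B e (x - d)).
Proof.
rewrite /edge_factor /edge_cost; case: (e \in tedge n) => hd; last first.
  by rewrite mul1r; case: (e \in B) => /=; rewrite ?mulr0 ?mulr1 ?expr0n ?expr1n.
have beta2 : (b0^-1 * eta e) ^+ 2 = b0^-1 ^+ 2 * eta e ^+ 2 by rewrite exprMn.
have Cee : Ce * eta e ^+ 2 = 96 * (b0^-1 * eta e) ^+ 2 + M * eta e ^+ 2 by rewrite beta2 /Ce; ring.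
have Me0 : 0 <= M * eta e ^+ 2 by rewrite mulr_ge0 ?sqr_ge0.
have w20 x' : 0 <= w x' ^+ 2 by rewrite sqr_ge0.
case: (boolP (e \in B)) hd => eB hd.
  (* A closed edge has cost zero, so it is not shifted and only the change of cutoff has to be
     paid. *)
  have -> : d = 0 by apply/eqP; rewrite -normr_le0.
  rewrite addr0 subr0 [leRHS](_ : _ = w x ^+ 2 * (expR (Ce * eta e ^+ 2) * (1 - z' e x) ^+ 2)); last by ring.
  rewrite [leLHS]exprMn ler_wpM2l//.
  have h := closed_factor a0 b0_gt0 (eta_ge0 e) (eta_small e) x.
  apply: (le_trans h).
  by rewrite ler_wpM2r ?sqr_ge0// Cee ler_expR lerDl.
have /andP[z0 z1] := zeta01 a0 b0 x.
have zz x' : 0 <= z' e x' by have /andP[] := zeta'01 a0 b0_gt0 (eta_ge0 e) (eta_small e) x'.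
(* Beyond a0 + b0 the open factor vanishes; below it x + d and x - d stay in [-1, 1], where [w_semi]
   applies. *)
have [h|h] := leP (a0 + b0) `|x|.
  rewrite /z zeta_outside// mulr0 expr0n/=.
  by rewrite !mulr_ge0 ?expR_ge0.
have de : `|d| <= b0 / 8.
  apply: (le_trans hd); rewrite -(mulVKf (lt0r_neq0 b0_gt0) (eta e)).
  by have := ler_wpM2l (ltW b0_gt0) (eta_small e); rewrite -/b0; lra.
have hb : a0 + b0 + b0 / 8 <= 1 by rewrite /a0 /b0; have := eps_gt0; lra.
have h1 : `|x - d| <= 1 by apply: (le_trans (ler_normB _ _)); lra.
have h2 : `|x + d| <= 1 by apply: (le_trans (ler_normD _ _)); lra.
have d2 : d ^+ 2 <= eta e ^+ 2.
  by rewrite -[leLHS]real_normK ?num_real// lerXn2r ?nnegrE.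
have hw : w x ^+ 2 <= expR (M * eta e ^+ 2) * (w (x + d) * w (x - d)).
  apply: (le_trans (w_semi h1 h2)); rewrite ler_wpM2r ?mulr_ge0//.
  by rewrite ler_expR ler_wpM2l.
have hz := open_factor b0_gt0 a0_ge0 (eta_ge0 e) (eta_small e) x hd.
rewrite Cee expRD exprMn.
have -> : expR (96 * (b0^-1 * eta e) ^+ 2) * expR (M * eta e ^+ 2) *
   (w (x + d) * z' e (x + d) * (w (x - d) * z' e (x - d))) =
   (expR (M * eta e ^+ 2) * (w (x + d) * w (x - d))) *
   (expR (96 * (b0^-1 * eta e) ^+ 2) * (z' e (x + d) * z' e (x - d))) by ring.
by apply: ler_pM; rewrite ?sqr_ge0.
Qed.

Let D := \sum_(e in tedge n) eta e ^+ 2.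

Lemma bweight_shift (B : {set V * V}) (s : V -> R) (phi : V -> R) :
  (forall e, e \in tedge n -> `|s e.1 - s e.2| <= edge_cost eta B e) ->
  bweight w z B phi ^+ 2 <= expR (Ce / 2 * D) ^+ 2 *
    (bweight w z' B (fun u => phi u + s u) * bweight w z' B (fun u => phi u - s u)).
Proof.
move=> hs.
have -> : expR (Ce / 2 * D) ^+ 2 = \prod_e (if e \in tedge n then expR (Ce * eta e ^+ 2) else 1).
  rewrite -expRM_natl -big_mkcond/= -expR_sum; congr expR.
  by rewrite /D -mulr_sumr; field.
rewrite /bweight -big_split/= -big_split/= -prodrXl; apply: ler_prod => e _.
rewrite sqr_ge0/=.
have -> : phi e.1 + s e.1 - (phi e.2 + s e.2) = (phi e.1 - phi e.2) + (s e.1 - s e.2) by ring.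
have -> : phi e.1 - s e.1 - (phi e.2 - s e.2) = (phi e.1 - phi e.2) - (s e.1 - s e.2) by ring.
case: (boolP (e \in tedge n)) => eE.
  by have := edge_factor_shift (phi e.1 - phi e.2) (hs e eE); rewrite eE.
by rewrite /edge_factor (negbTE eE) mul1r -expr2.
Qed.

(** A nonzero closed factor requires zeta < 1 there, hence a gradient of at least 1 - eps. Closed
    sets are thus dominated by [closed_edges]. *)
Lemma bweight_closed (B : {set V * V}) (phi : V -> R) : bweight w z B phi != 0 ->
  B \subset closed_edges a0 phi.
Proof.
move=> nz; apply/fintype.subsetP => e eB.
have : edge_factor w z B e (phi e.1 - phi e.2) != 0.
  by apply: contra nz => /eqP h; rewrite /bweight (bigD1 e)//= h mul0r.
rewrite /edge_factor eB /=; case: (boolP (e \in tedge n)) => eE; last by rewrite eqxx.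
rewrite mulf_eq0 negb_or => /andP[_ h]; rewrite /closed_edges finset.in_set eE /= leNgt; apply: contra h => h.
by rewrite /z zeta_inside ?subrr// ltW.
Qed.

Lemma shift_bound (v : V) (T lam : R) (J : R -> bool) : 0 <= T -> 0 < lam ->
  measurable_fun setT J ->
  (forall B p, good_set l B -> path (@tadj n) v p -> uniq (v :: p) -> last v p = origin n ->
     T <= path_cost eta B v p) ->
  (gint w (fun phi : V -> R => good_set l (closed_edges a0 phi) && J (phi v)) <=
   (expR (Ce / 2 * D) / 2)%:E * (lam%:E * gint w (fun phi : V -> R => J (phi v - T)%R)
      + (lam^-1)%:E * gint w (fun phi : V -> R => J (phi v + T)%R)))%E.
Proof.
move=> T0 l0 mJ hT.
(* The profile is chosen separately for each good B; for the other sets any value serves, here 0. *)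
have ex B : exists s : V -> R, good_set l B -> [/\ s (origin n) = 0, s v = T &
    forall e, e \in tedge n -> `|s e.1 - s e.2| <= edge_cost eta B e].
  have [gB|] := boolP (good_set l B); last by exists (fun=> 0).
  have [s hs] := exists_profile (B := B) eta_ge0 T0 (fun p => hT B p gB).
  by exists s.
have [s hs] := choice ex.
apply: (@deformation _ _ _ w_ge0 mw z z' (good_set l) s
  (fun phi => good_set l (closed_edges a0 phi)) J v T (expR (Ce / 2 * D)) lam) => //.
- by move=> e; apply: measurable_zeta.
- by move=> e x; apply: zeta01.
- move=> e; apply: measurable_funB => //; apply: measurable_funM => //.
  by apply: measurable_funB => //; apply: measurable_zeta.
- by move=> e x; apply: zeta'01.
- exact: rfield_closed_edges.
- move=> B phi gphi nz; exact: good_setS (bweight_closed nz) gphi.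
- by move=> B /hs[].
- by move=> B phi /hs[_ _ h]; exact: bweight_shift.
Qed.

End Shift.

(** * Passage distance for radial gradients *)

Section RadialPassage.
Set Implicit Arguments. Unset Strict Implicit. Unset Printing Implicit Defensive.
Context {R : realType}.
Variables n l : nat.
Local Notation V := (tvert n).

(** A logarithmic height function [S], cut off below r0 and above |v|, satisfies the hypotheses of
    [passage_time_ge] at the scale of 20 l steps. *)
Lemma radial_passage (v : V) (r0 b : R) (B : {set V * V}) p : (0 < l)%N -> 0 <= b -> 0 < r0 ->
  (20 * l)%:R <= r0 / 4 -> r0 <= (nrm v)%:R -> good_set l B ->
  path (@tadj n) v p -> uniq (v :: p) -> last v p = origin n ->
  b * ln ((nrm v)%:R / r0) <= path_cost (radial_grad (40 * b) (r0 / 2) (2 * nrm v)) B v p.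
Proof.
move=> l0 b0 r00 hL hk gB vp up lp; set k := nrm v in hk *.
pose S (r : nat) : R := b * Num.max 0 (ln ((minn r k)%:R / r0)).
have b40 : 0 <= 40 * b by rewrite mulr_ge0.
have Sle x y : (x <= y)%N -> S x <= S y.
  move=> xy; rewrite /S ler_wpM2l// ge_max le_max lexx /=.
  case: (posnP (minn x k)) => [->|h]; first by rewrite mul0r ln0// le_max lexx.
  rewrite le_max; apply/orP; right; rewrite ler_ln ?posrE ?divr_gt0 ?ltr0n//.
  - by rewrite ler_wpM2r ?invr_ge0 ?(ltW r00)// ler_nat; lia.
  - lia.
have S0 x : x%:R <= r0 -> S x = 0.
  move=> hx; rewrite /S max_l ?mulr0// ln_le0// ler_pdivrMr// mul1r.
  by apply: le_trans hx; rewrite ler_nat geq_minl.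
have SP x : 0 <= S x by rewrite /S mulr_ge0// le_max lexx.
have Sk : b * ln (k%:R / r0) <= S k.
  by rewrite /S minnn ler_wpM2l// le_max lexx orbT.
apply: (le_trans Sk).
apply: (passage_time_ge (l := l)) => //.
- by move=> e; exact: radial_grad_ge0.
- move=> r hr; rewrite S0//; apply: (@le_trans _ _ (20 * l)%:R); first by rewrite ler_nat ltnW.
  by apply: (le_trans hL); lra.
move=> r q rq.
have triv : S r - S q <= 0 -> exists m, [/\ 0 <= m, S r - S q <= l%:R * m &
     forall e : V * V, e \in tedge n -> (nrm e.1 <= q + 20 * l)%N -> (q <= nrm e.1 + 20 * l)%N ->
       m <= radial_grad (40 * b) (r0 / 2) (2 * k) e].
  move=> h; exists 0; split => //; first by rewrite mulr0.
  by move=> e _ _ _; exact: radial_grad_ge0.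
have [h1|h1] := leP (r%:R : R) r0; first by apply: triv; rewrite S0// sub0r oppr_le0.
have [h2|h2] := leqP k q.
  apply: triv; rewrite subr_le0; apply: (@le_trans _ _ (S k)); last exact: Sle.
  have [rk|rk] := leqP r k; first exact: Sle.
  by rewrite /S (minn_idPr (ltnW rk)) minnn.
have rq' : (r%:R : R) <= q%:R + (20 * l)%:R by rewrite -natrD ler_nat.
have hq : 3 / 4 * r0 <= (q%:R : R) by lra.
have q0 : 0 < (q%:R : R) by lra.
have rp : 0 < (r%:R : R) by lra.
(* Over one block [S] grows by at most 20 l b / q, that is l times this m. The nearby edges have
   norm at most 2 q, so gradients 40 b / |e| are at least m; the factor 40 is chosen for this. *)
exists (20 * b / q%:R); split.
- by rewrite divr_ge0 ?mulr_ge0// ltW.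
- have Sr : S r <= b * ln (r%:R / r0).
    rewrite /S ler_wpM2l// ge_max; apply/andP; split.
      by rewrite ln_ge0// ler_pdivlMr// mul1r ltW.
    have r1 : (0 < r)%N by rewrite ltr0n in rp.
    have k1 : (0 < k)%N := leq_ltn_trans (leq0n q) h2.
    have mp : 0 < ((minn r k)%:R : R) by rewrite ltr0n leq_min r1 k1.
    rewrite ler_ln ?posrE ?divr_gt0// ler_wpM2r ?invr_ge0 ?(ltW r00)// ler_nat; exact: geq_minl.
  have Sq : b * ln (q%:R / r0) <= S q.
    by rewrite /S (minn_idPl (ltnW h2)) ler_wpM2l// le_max lexx orbT.
  have lrq : ln (r%:R / r0) - ln (q%:R / r0) <= (20 * l)%:R / q%:R :> R.
    rewrite !ln_div ?posrE//.
    have -> : ln r%:R - ln r0 - (ln q%:R - ln r0) = ln r%:R - ln q%:R :> R by ring.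
    rewrite -ln_div ?posrE//.
    have -> : r%:R / q%:R = 1 + (r%:R / q%:R - 1) :> R by ring.
    apply: (le_trans (le_ln1Dx _)).
      have rq0 : 0 < r%:R / q%:R :> R by rewrite divr_gt0.
      lra.
    have -> : r%:R / q%:R - 1 = (r%:R - q%:R) / q%:R :> R by rewrite mulrBl divff// gt_eqF.
    by rewrite ler_wpM2r ?invr_ge0 ?(ltW q0)//; lra.
  apply: (@le_trans _ _ (b * (ln (r%:R / r0) - ln (q%:R / r0)))); first by rewrite mulrBr; lra.
  have -> : l%:R * (20 * b / q%:R) = b * ((20 * l)%:R / q%:R) by rewrite natrM; ring.
  by rewrite ler_wpM2l.
move=> e eE; set u := nrm e.1 => hu1 hu2.
have u1 : (u%:R : R) <= q%:R + (20 * l)%:R by rewrite -natrD ler_nat.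
have u2 : (q%:R : R) <= u%:R + (20 * l)%:R by rewrite -natrD ler_nat.
have qk : (q%:R : R) <= k%:R by rewrite ler_nat ltnW.
have c1 : r0 / 2 <= u%:R by lra.
have c2 : (u <= 2 * k)%N by rewrite -(ler_nat R) natrM; lra.
have up0 : 0 < (u%:R : R) by lra.
rewrite /radial_grad -/u c1 c2 /= ler_pdivrMr// mulrAC ler_pdivlMr//.
have -> : 40 * b * q%:R = 20 * b * (2 * q%:R) by ring.
by apply: ler_wpM2l; [rewrite mulr_ge0|lra].
Qed.

End RadialPassage.

(** * The shift inequality with explicit constants *)

Section ShiftMain.
Set Implicit Arguments. Unset Strict Implicit. Unset Printing Implicit Defensive.
Context {R : realType}.

Lemma ln2_ge_half : 1 / 2 <= ln 2 :> R.
Proof.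
have := @le_ln1Dx R (- (1 / 2)); rewrite (_ : 1 + - (1 / 2) = 2^-1); last by field.
rewrite lnV ?posrE// => h; have := h ltac:(lra); lra.
Qed.

Lemma ln2_le1 : ln 2 <= 1 :> R.
Proof. by have := @le_ln1Dx R 1; rewrite -[1 + 1]/2; apply; lra. Qed.

Lemma up_log_le n : (2 <= n)%N -> ((up_log 2 n)%:R : R) <= 2 * ln n%:R + 1.
Proof.
move=> n2; have l0 : (0 < up_log 2 n)%N by rewrite up_log_gt0.
have /andP[h _] := up_log_bounds (isT : (1 < 2)%N) n2.
have h' : ln (2 ^+ (up_log 2 n).-1) <= ln n%:R :> R.
  rewrite ler_ln ?posrE.
  - by rewrite -natrX ler_nat ltnW.
  - exact: exprn_gt0.
  - by rewrite ltr0n ltnW.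
have e1 : (up_log 2 n)%:R = (up_log 2 n).-1%:R + 1 :> R by rewrite natr1 prednK.
move: h' e1; set j := (up_log 2 n).-1; rewrite lnXn// => h' e1.
have e2 : ln 2 *+ j = j%:R * ln 2 :> R by rewrite mulr_natl.
have p0 : 0 <= j%:R :> R by [].
have := ler_wpM2l p0 ln2_ge_half; lra.
Qed.

Lemma ln1D_le (k : R) : 2 <= k -> ln (1 + k) <= 2 * ln k.
Proof.
move=> k2; have k0 : 0 < k by lra.
have -> : 2 * ln k = ln (k ^+ 2) by rewrite lnXn// mulr_natl.
rewrite ler_ln ?posrE ?exprn_gt0//; first by rewrite expr2; nra.
lra.
Qed.

Variable w : R -> R.
Hypothesis w_ge0 : forall x, 0 <= w x.
Hypothesis mw : measurable_fun setT w.
Variables (eps M : R).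
Hypothesis eps_gt0 : 0 < eps.
Hypothesis eps_half : eps <= 1 / 2.
Hypothesis M_ge0 : 0 <= M.
Hypothesis w_semi : forall x d, `|x - d| <= 1 -> `|x + d| <= 1 ->
  w x ^+ 2 <= expR (M * d ^+ 2) * (w (x + d) * w (x - d)).

Let beta := (eps / 2)^-1.
Let Ce := 96 * beta ^+ 2 + M.
Let C0 := Ce / 2 * (48 * 320 ^+ 2).
(** The first term makes ln(k / r0) at least ln k / 4 for k = |v|; the second keeps the gradients
    small compared with the width of the cutoff. *)
Let A := 4 * ln 240 + 1024 * beta ^+ 2 + 1.

(** The profile climbs to height T between distances of order sqrt |v| and |v|. The hypothesis (log
    n)^2 <= |v| makes blocks of 20 log_2 n steps short on the scale sqrt |v|, and the bound on T
    keeps the gradients small. *)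
Lemma shift_main n (v : tvert n) (T lam : R) (J : R -> bool) :
  (2 <= n)%N -> ln (n%:R : R) ^+ 2 <= (nrm v)%:R -> A <= ln (nrm v)%:R ->
  0 <= T -> T <= 2 * Num.sqrt (nrm v)%:R * Num.sqrt (ln (1 + (nrm v)%:R)) ->
  0 < lam -> measurable_fun setT J ->
  (gint w (fun phi : tvert n -> R => good_set (up_log 2 n) (closed_edges (1 - eps) phi) && J (phi v)) <=
   (expR (C0 * (T ^+ 2 / ln (1 + (nrm v)%:R))) / 2)%:E *
      (lam%:E * gint w (fun phi : tvert n -> R => J (phi v - T)%R)
      + (lam^-1)%:E * gint w (fun phi : tvert n -> R => J (phi v + T)%R)))%E.
Proof.
move=> n2 hnk hA T0 hT lam0 mJ.
set k : R := (nrm v)%:R in hnk hA hT *.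
have be0 : 0 < beta by rewrite invr_gt0 divr_gt0.
have Ce0 : 0 <= Ce by rewrite addr_ge0// mulr_ge0// sqr_ge0.
have l240 : 0 <= ln 240 :> R by rewrite ln_ge0//; lra.
have be20 : 0 <= beta ^+ 2 by rewrite sqr_ge0.
have lk1 : 1 <= ln k by move: hA; rewrite /A; lra.
have k0 : 0 < k by rewrite ltNge; apply/negP => h; move: lk1; rewrite ln0//; lra.
have k2 : 2 <= k.
  have : ln 2 <= ln k by have := ln2_le1; lra.
  by rewrite ler_ln ?posrE.
set s := Num.sqrt k.
have ss : s * s = k by rewrite -expr2 sqr_sqrtr// ltW.
have s0 : 0 < s by rewrite sqrtr_gt0.
have s1 : 1 <= s by rewrite -sqrtr1 ler_wsqrtr//; lra.
have lks : ln k = 2 * ln s by rewrite -ss lnM ?posrE//; ring.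
have lns : ln n%:R <= s.
  have := ler_wsqrtr hnk; rewrite sqrtr_sqr; exact/le_trans/ler_norm.
set l := up_log 2 n.
have l0 : (0 < l)%N by rewrite up_log_gt0.
have hl : (20 * l)%:R <= 60 * s by have := up_log_le n2; rewrite natrM -/l; lra.
(* Chosen so that 20 l <= 60 s = r0 / 4, as [radial_passage] requires. *)
pose r0 := 240 * s.
have r00 : 0 < r0 by apply: mulr_gt0; [exact: ltr0Sn|exact: s0].
have lkr : ln k / 4 <= ln (k / r0).
  have -> : ln (k / r0) = ln k - (ln 240 + ln s).
    by rewrite ln_div ?posrE// lnM ?posrE; [|exact: ltr0Sn|exact: s0].
  by move: hA; rewrite /A lks; lra.
have lkr0 : 0 < ln (k / r0) by lra.
have r0k : r0 <= k.
  rewrite leNgt; apply/negP => h; move: lkr0; rewrite ltNge => /negP; apply.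
  by rewrite ln_le0// ler_pdivrMr// mul1r ltW.
(* The slope for which the logarithmic profile reaches exactly T at v. *)
pose b := T / ln (k / r0).
have b0 : 0 <= b by rewrite divr_ge0// ltW.
have bT : b * ln (k / r0) = T by rewrite divfK// gt_eqF.
have lk0 : 0 < ln k by lra.
have bl : b * ln k <= 4 * T by rewrite -bT; have := ler_wpM2l b0 lkr; lra.
pose eta := radial_grad (n := n) (40 * b) (r0 / 2) (2 * nrm v).
have b40 : 0 <= 40 * b by rewrite mulr_ge0.
have eta0 e : 0 <= eta e by apply: radial_grad_ge0.
set L1 := ln (1 + k) in hT *.
have L12 : L1 <= 2 * ln k by apply: ln1D_le.
have L10 : 0 < L1 by rewrite /L1 ln_gt0//; lra.
have sL1 : Num.sqrt L1 * Num.sqrt L1 = L1 by rewrite -expr2 sqr_sqrtr// ltW.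
(* The steepest gradient is 40 b / (r0 / 2) = b / (3 s), of order sqrt(L1) / ln k by the bounds on T
   and b; this is small since ln k >= 1024 beta^2. *)
have eta_small e : beta * eta e <= 1 / 8.
  have r20 : 0 < r0 / 2 by rewrite divr_gt0.
  have h1 : eta e <= b / (3 * s).
    apply: (le_trans (radial_grad_le _ _ b40 r20)).
    by rewrite le_eqVlt; apply/orP; left; apply/eqP; rewrite /r0; field; exact: lt0r_neq0.
  have h2 : b / (3 * s) * ln k <= 8 / 3 * Num.sqrt L1.
    have -> : b / (3 * s) * ln k = b * ln k / (3 * s) by ring.
    rewrite ler_pdivrMr ?mulr_gt0//; apply: (le_trans bl).
    apply: (@le_trans _ _ (4 * (2 * s * Num.sqrt L1))); first by rewrite ler_wpM2l.
    by rewrite le_eqVlt; apply/orP; left; apply/eqP; field.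
  have h3 : beta * (8 / 3 * Num.sqrt L1) <= 1 / 8 * ln k.
    have be0' := ltW be0; have lk0' := ltW lk0.
    rewrite -(ler_pXn2r (n := 2))// ?nnegrE; last 2 first.
    - by rewrite !mulr_ge0 ?sqrtr_ge0.
    - by rewrite mulr_ge0.
    have -> : (beta * (8 / 3 * Num.sqrt L1)) ^+ 2 = 64 / 9 * beta ^+ 2 * (Num.sqrt L1 * Num.sqrt L1) by field.
    rewrite sL1.
    have -> : (1 / 8 * ln k) ^+ 2 = 1 / 64 * (ln k * ln k) by field.
    have e1 : 1024 * beta ^+ 2 <= ln k by move: hA; rewrite /A; lra.
    have e2 : 1024 * beta ^+ 2 * ln k <= ln k * ln k by rewrite ler_wpM2r// ltW.
    have e3 : beta ^+ 2 * L1 <= beta ^+ 2 * (2 * ln k) by rewrite ler_wpM2l.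
    have e4 : 0 <= beta ^+ 2 * ln k by rewrite mulr_ge0// ltW.
    lra.
  rewrite -(ler_pM2r lk0); apply: le_trans h3.
  rewrite -[leLHS]mulrA ler_wpM2l ?(ltW be0)//; apply: le_trans h2.
  by rewrite ler_wpM2r// ltW.
have := @shift_bound R n l w w_ge0 mw eps M eps_gt0 eps_half M_ge0 w_semi eta eta0 eta_small v T lam J T0 lam0 mJ.
have pass B p : good_set l B -> path (@tadj n) v p -> uniq (v :: p) -> last v p = origin n ->
     T <= path_cost eta B v p.
  move=> gB vp up lp; rewrite -bT; apply: (radial_passage (l := l)) => //.
  by apply: (le_trans hl); rewrite /r0; lra.
move=> /(_ pass) h; apply: (le_trans h).
apply: lee_wpmul2r.
  have tg (f : (tvert n -> R) -> bool) : (0 <= gint w f)%E.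
    by apply: iint_ge0 => phi; rewrite lee_fin mulr_ge0// gweight_ge0.
  by rewrite adde_ge0// mule_ge0// lee_fin ?invr_ge0 ltW.
rewrite lee_fin ler_wpM2r// ler_expR /C0 -[leRHS]mulrA.
apply: ler_wpM2l; first by rewrite divr_ge0.
have r20 : 0 < r0 / 2 by rewrite divr_gt0.
apply: (le_trans (radial_energy_le n (2 * nrm v) b40 r20)).
have l2k : 1 + ln (2 * nrm v)%:R <= 3 * ln k.
  by rewrite natrM lnM ?posrE//; have := ln2_le1; rewrite -/k; lra.
apply: (@le_trans _ _ (32 * (40 * b) ^+ 2 * (3 * ln k))).
  by rewrite ler_wpM2l// mulr_ge0// sqr_ge0.
have -> : 48 * 320 ^+ 2 * (T ^+ 2 / L1) = (48 * 320 ^+ 2 * T ^+ 2) / L1 by rewrite mulrA.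
rewrite ler_pdivlMr//.
(* The energy times L1 is at most 32 (40 b)^2 (3 ln k)(2 ln k), which is 3 (320)^2 (b ln k)^2, and b
   ln k <= 4 T yields the factor 48 (320)^2. *)
have c1 : (b * ln k) ^+ 2 <= (4 * T) ^+ 2.
  by apply: lerXn2r => //; rewrite nnegrE mulr_ge0// ltW.
have c2 : 32 * (40 * b) ^+ 2 * (3 * ln k) * L1 <= 32 * (40 * b) ^+ 2 * (3 * ln k) * (2 * ln k).
  by apply: ler_wpM2l => //; apply: mulr_ge0; apply: mulr_ge0; rewrite ?sqr_ge0// ltW.
apply: (le_trans c2).
have -> : 32 * (40 * b) ^+ 2 * (3 * ln k) * (2 * ln k) = 3 * 320 ^+ 2 * (b * ln k) ^+ 2 by ring.
have c3 : 0 <= 3 * 320 ^+ 2 :> R by apply: mulr_ge0; [exact: ler0n|exact: sqr_ge0].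
apply: (le_trans (ler_wpM2l c3 c1)).
by rewrite le_eqVlt; apply/orP; left; apply/eqP; ring.
Qed.

End ShiftMain.

(** * Gibbs probabilities *)

Section Gibbs.
Set Implicit Arguments. Unset Strict Implicit. Unset Printing Implicit Defensive.
Context {R : realType}.
Variable U : R -> \bar R.
Hypothesis mU : measurable_fun setT U.
Hypothesis symU : forall x, U x = U (- x).
Variable m : R.
Hypothesis lowU : forall x, (m%:E <= U x)%E.
Hypothesis intU : (\int[lebesgue_measure]_x expeR (- U x) < +oo)%E.
Variable g : R -> R.
Hypothesis dg : forall x, derivable g x 1.
Hypothesis ddg : forall x, derivable (derive1 g) x 1.
Hypothesis cg : continuous (derive1n 2 g).
Hypothesis Ug : forall x : R, -1 <= x <= 1 -> U x = (g x)%:E.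

(** The factor exp(-U) as a real number: it is 0 where U is infinite, and the lower bound on U keeps
    it finite. *)
Definition bfac (x : R) : R := fine (expeR (- U x)).

Lemma bfacE x : expeR (- U x)%E = (bfac x)%:E.
Proof. by rewrite /bfac; have := lowU x; case: (U x). Qed.

Lemma bfac_ge0 x : 0 <= bfac x.
Proof. by rewrite /bfac fine_ge0// expeR_ge0. Qed.

Lemma bfac_sym x : bfac (- x) = bfac x.
Proof. by rewrite /bfac -symU. Qed.

Lemma bfac_le x : bfac x <= Num.max 1 (expR (- m)).
Proof.
rewrite le_max; apply/orP; right; rewrite -lee_fin -bfacE.
have -> : (expR (- m))%:E = expeR (- m%:E)%E by [].
by rewrite lee_expeR leeN2.
Qed.

Lemma measurable_bfac : measurable_fun setT bfac.
Proof.
have -> : bfac = fun x => expR (- fine (U x)) * \1_(~` (U @^-1` [set +oo%E])) x.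
  apply/funext => x; rewrite /bfac indicE.
  have := lowU x; case E : (U x) => [r| |] // _ /=.
  - by rewrite mem_set ?mulr1//= => h; rewrite h in E.
  - by rewrite memNset ?mulr0//= => h; exact: h.
apply: measurable_funM.
  apply: measurableT_comp => //; apply: measurableT_comp => //.
  by apply: measurableT_comp.
apply: measurable_indic; apply: measurableC.
by rewrite -[X in measurable X]setTI; apply: mU => //; exact: emeasurable_set1.
Qed.

Lemma int_bfac : (\int[lebesgue_measure]_x (bfac x)%:E < +oo)%E.
Proof. by under eq_integral do rewrite -bfacE. Qed.

Lemma bfac_core x : -1 <= x <= 1 -> bfac x = expR (- g x).
Proof. by move=> h; rewrite /bfac Ug. Qed.

Lemma bfac_core_gt0 : exists c, 0 < c /\ forall x, -1 <= x <= 1 -> c <= bfac x.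
Proof.
have [||G [G0 hG]] := @continuous_bounded_itv R g (-1) 1; first lra.
  by move=> x; exact/differentiable_continuous/derivable1_diffP.
exists (expR (- G)); split; first exact: expR_gt0.
move=> x h; rewrite bfac_core// ler_expR lerN2.
by have := hG x h; rewrite ler_norml => /andP[].
Qed.

(** Exponential form of the second difference bound for U on [-1, 1]. *)
Lemma bfac_semiconvex : exists M, 0 <= M /\ forall x d, `|x - d| <= 1 -> `|x + d| <= 1 ->
  bfac x ^+ 2 <= expR (M * d ^+ 2) * (bfac (x + d) * bfac (x - d)).
Proof.
have [M [M0 hM]] := second_difference_le dg ddg cg.
exists M; split => // x d; rewrite !ler_norml => h1 h2.
rewrite !bfac_core; [|lra|lra|lra].
rewrite -expRM_natl -!expRD ler_expR.
have := hM x d ltac:(lra) ltac:(lra) ltac:(lra) ltac:(lra); lra.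
Qed.

Section Torus.
Variable n : nat.
Local Notation V := (tvert n).
Local Notation w := bfac.

(** Since U is never -oo, the extended sums are unambiguous and the exponential turns them into
    products. *)
Lemma weightE (phi : V -> R) : weight U phi = (gweight w phi)%:E.
Proof.
have D (x y : \bar R) : (-oo < x)%E -> (-oo < y)%E -> expeR (- (x + y))%E = (expeR (- x) * expeR (- y))%E.
  by move=> x0 y0; rewrite -expeRD; congr expeR; move: x0 y0; case: x => [x| |] //; case: y => [y| |] //; rewrite -?EFinD//= opprD.
have L x : (-oo < U x)%E by apply: lt_le_trans (lowU x); exact: ltNyr.
rewrite /weight /energy /gweight.
suff [] : (-oo < \sum_(e in tedge n) U (phi e.1 - phi e.2)%R)%E /\
  expeR (- \sum_(e in tedge n) U (phi e.1 - phi e.2)%R)%E = (\prod_(e in tedge n) w (phi e.1 - phi e.2))%:E by [].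
elim/big_ind2 : _; first by rewrite oppe0 expeR0.
- by move=> x1 y1 x2 y2 [a1 b1] [a2 b2]; rewrite D// b1 b2; split => //; move: a1 a2; case: x1 {b1} => [x| |] //; case: x2 {b2} => [x'| |] //; rewrite -?EFinD ?ltNyr.
- by move=> e _; rewrite bfacE.
Qed.

Local Notation Zw := (gint w (fun _ : V -> R => true)).

(** In the box of half-width [kap] around [g0] every gradient stays in [-1, 1], where each factor is
    at least c. *)
Lemma gint_ge_box (b : (V -> R) -> bool) (g0 : V -> R) (kap : R) (c : R) : 0 <= c -> 0 <= kap -> rfield b ->
  (forall x, -1 <= x <= 1 -> c <= w x) -> g0 (origin n) = 0 ->
  (forall e, e \in tedge n -> `|g0 e.1 - g0 e.2| + 2 * kap <= 1) ->
  (forall psi : V -> R, (forall u, `|psi u - g0 u| <= kap) -> b psi) ->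
  ((c ^+ #|tedge n| * (2 * kap) ^+ size (free_verts n))%:E <= gint w b)%E.
Proof.
move=> c0 k0 mb hc g00 hg hb; rewrite /gint /tint -/(free_verts n).
apply: (@iint_box_ge _ _ _ _ _ g0) => //.
- exact: (nnm_gint bfac_ge0 measurable_bfac).
- exact: exprn_ge0.
- move=> psi0 hpsi; rewrite hb// mul1r lee_fin /gweight -prodr_const; apply: ler_prod => e eE.
  rewrite c0 /=; apply: hc; rewrite -ler_norml.
  have := hg e eE; have := hpsi e.1; have := hpsi e.2; rewrite distrC => h2 h1 h.
  have -> : psi0 e.1 - psi0 e.2 = (psi0 e.1 - g0 e.1) + (g0 e.1 - g0 e.2) + (g0 e.2 - psi0 e.2) by ring.
  apply: (le_trans (ler_normD _ _)); have := ler_normD (psi0 e.1 - g0 e.1) (g0 e.1 - g0 e.2); lra.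
- move=> u; rewrite mem_free_verts negbK => /eqP ->; by rewrite g00 subr0 normr0.
Qed.

Lemma Z_fin : (Zw < +oo)%E.
Proof.
apply: (@gint_fin _ _ _ bfac_ge0 measurable_bfac bfac_sym (Num.max 1 (expR (- m)))).
- by rewrite le_max lexx.
- exact: bfac_le.
- exact: int_bfac.
Qed.

Lemma Z_gt0 : (0 < Zw)%E.
Proof.
have [c [c0 hc]] := bfac_core_gt0.
have h := @gint_ge_box (fun=> true) (fun=> 0) (1 / 2) c (ltW c0) ltac:(lra) (rfield_cst true) hc erefl.
apply: lt_le_trans (h _ _) => //.
- by rewrite lte_fin mulr_gt0// exprn_gt0// mulr_gt0//; lra.
- by move=> e _; rewrite subr0 normr0; lra.
Qed.

Let z := fine Zw.
Lemma zE : Zw = z%:E.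
Proof. by rewrite /z fineK// ge0_fin_numE ?Z_fin// ltW// Z_gt0. Qed.

Lemma z_gt0 : 0 < z.
Proof. by have := Z_gt0; rewrite zE lte_fin. Qed.

Definition pr (b : (V -> R) -> bool) : R := fine (gint w b) / z.

Lemma gintE (b : (V -> R) -> bool) : rfield b -> gint w b = (pr b * z)%:E.
Proof.
move=> mb; rewrite /pr divfK ?gt_eqF ?z_gt0// fineK// ge0_fin_numE.
- by apply: le_lt_trans Z_fin; apply: (gint_le bfac_ge0 measurable_bfac) => //; exact: rfield_cst.
- by apply: iint_ge0 => phi; rewrite lee_fin mulr_ge0// gweight_ge0//; exact: bfac_ge0.
Qed.

Lemma Zpart_E : Zpart n U = z%:E.
Proof. by rewrite -zE; apply: eq_iint => phi; rewrite weightE mul1r. Qed.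

Lemma Pmu_pr (A : set (V -> R)) (b : (V -> R) -> bool) : (forall phi, A phi <-> b phi) -> rfield b ->
  Pmu U A = (pr b)%:E.
Proof.
move=> Ab mb; rewrite /Pmu /Emu Zpart_E /=.
transitivity (gint w b * (z^-1)%:E)%E.
  congr (_ * _)%E; apply: eq_iint => phi; rewrite weightE -EFinM indicE; congr (_ * _)%:E.
  congr (_%:R); congr nat_of_bool; apply/idP/idP; rewrite inE => /Ab//.
by rewrite gintE// -EFinM mulfK// gt_eqF// z_gt0.
Qed.

Lemma pr_le (b b' : (V -> R) -> bool) : rfield b -> rfield b' -> (forall phi, b phi -> b' phi) -> pr b <= pr b'.
Proof.
move=> mb mb' h; have := gint_le bfac_ge0 measurable_bfac mb mb' h.
by rewrite !gintE// lee_fin ler_pM2r// z_gt0.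
Qed.

Lemma pr_ge0 b : 0 <= pr b.
Proof.
rewrite divr_ge0 ?(ltW z_gt0)// fine_ge0//.
by apply: iint_ge0 => phi; rewrite lee_fin mulr_ge0// gweight_ge0//; exact: bfac_ge0.
Qed.

Lemma pr_true : pr (fun=> true) = 1.
Proof. by rewrite /pr -/z divff// gt_eqF// z_gt0. Qed.

Lemma pr_le1 (b : (V -> R) -> bool) : rfield b -> pr b <= 1.
Proof. by move=> mb; rewrite -pr_true; apply: pr_le => //; exact: rfield_cst. Qed.

Lemma pr_sum_le (I : finType) (P : pred I) (b : I -> (V -> R) -> bool) (b' : (V -> R) -> bool) :
  (forall i, rfield (b i)) -> rfield b' ->
  (forall phi, \sum_(i | P i) (b i phi)%:R <= (b' phi)%:R :> R) ->
  \sum_(i | P i) pr (b i) <= pr b'.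
Proof.
move=> mb mb' h; rewrite -(ler_pM2r z_gt0) mulr_suml -lee_fin -sumEFin -gintE//.
rewrite (eq_bigr (fun i => gint w (b i))); last by move=> i _; rewrite gintE.
rewrite /gint /tint -iint_sum; last by move=> i _; exact: (nnm_gint bfac_ge0 measurable_bfac).
apply: le_iint.
- by apply: nnm_sum => i _; exact: (nnm_gint bfac_ge0 measurable_bfac).
- exact: (nnm_gint bfac_ge0 measurable_bfac).
- move=> phi; rewrite sumEFin lee_fin -mulr_suml ler_wpM2r//; exact: (gweight_ge0 bfac_ge0).
Qed.

Lemma pr_split (b c : (V -> R) -> bool) : rfield b -> rfield c -> pr b <= pr (fun phi => c phi && b phi) + pr (fun phi => ~~ c phi).
Proof.
move=> mb mc; have mcb := rfield_and mc mb; have mnc := rfield_not mc.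
rewrite -(ler_pM2r z_gt0) mulrDl -lee_fin EFinD -!gintE//.
rewrite /gint /tint -iintD; [|exact: (nnm_gint bfac_ge0 measurable_bfac)..].
apply: le_iint; [exact: (nnm_gint bfac_ge0 measurable_bfac)| |].
- by apply: nnmD; exact: (nnm_gint bfac_ge0 measurable_bfac).
move=> phi; rewrite -EFinD lee_fin -mulrDl ler_wpM2r//; first exact: (gweight_ge0 bfac_ge0).
by case: (c phi); case: (b phi) => /=; rewrite ?addr0 ?add0r.
Qed.

Lemma gweight_opp (phi : V -> R) : gweight w (fun u => - phi u) = gweight w phi.
Proof.
by apply: eq_bigr => e _; rewrite -bfac_sym; congr w; ring.
Qed.

Lemma pr_opp (b : (V -> R) -> bool) : rfield b -> pr (fun phi => b (fun u => - phi u)) = pr b.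
Proof.
move=> mb; rewrite /pr; congr (fine _ / _).
rewrite -[RHS](@tint_opp _ _ _ (nnm_gint bfac_ge0 measurable_bfac mb)).
by apply: eq_iint => phi; rewrite gweight_opp.
Qed.

(** The positive and negative parts have equal expectations under phi -> -phi, as extended reals. *)
Lemma mean0 (v : V) : mean U v = 0.
Proof.
rewrite /mean; apply/eqP; rewrite subr_eq0; apply/eqP; congr fine.
rewrite /Emu; congr (_ * _)%E.
have nf : nnm (fun phi : V -> R => ((Num.max (phi v) 0)%:E * weight U phi)%E).
  apply: nnmM.
    apply: nnm_rfield; last by move=> phi; rewrite le_max lexx orbT.
    move=> d T Phi mPhi; apply: measurable_maxr => //; exact: mPhi.
  have -> : weight U = (fun phi : V -> R => (gweight w phi)%:E) by apply/funext => phi; exact: weightE.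
  by apply: nnm_rfield; [by apply: rfield_gweight; exact: measurable_bfac|move=> phi; exact: (gweight_ge0 bfac_ge0)].
rewrite -(tint_opp nf); apply: eq_iint => phi.
by rewrite !weightE gweight_opp.
Qed.

Lemma var_ge (v : V) (s : R) : 0 <= s ->
  ((s ^+ 2 * pr (fun phi => s <= `|phi v|))%:E <= var U v)%E.
Proof.
move=> s0; rewrite /var mean0 /Emu Zpart_E /=.
have mb : rfield (fun phi : V -> R => s <= `|phi v|).
  move=> d T Phi mPhi; apply: measurable_fun_ler; first exact: measurable_cst.
  by apply: measurableT_comp => //; exact: mPhi.
have wE : weight U = (fun phi : V -> R => (gweight w phi)%:E) by apply/funext => phi; exact: weightE.
have -> : (s ^+ 2 * pr (fun phi => s <= `|phi v|))%:E = ((s ^+ 2)%:E * gint w (fun phi : V -> R => (s <= `|phi v|)%R) * (z^-1)%:E)%E.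
  by rewrite (gintE mb) -!EFinM -!mulrA mulfV ?mulr1// gt_eqF// z_gt0.
apply: lee_wpmul2r; first by rewrite lee_fin invr_ge0 ltW// z_gt0.
have n1 := nnm_gint bfac_ge0 measurable_bfac mb.
rewrite /gint /tint -iintZ ?sqr_ge0//; apply: le_iint.
- by apply: nnmM => //; apply: nnm_cst; rewrite lee_fin sqr_ge0.
- rewrite wE; apply: nnmM.
    apply: nnm_rfield; last by move=> phi; exact: sqr_ge0.
    move=> d T Phi mPhi; apply: measurable_funX; apply: measurable_funB => //; exact: mPhi.
  by apply: nnm_rfield; [by apply: rfield_gweight; exact: measurable_bfac|move=> phi; exact: (gweight_ge0 bfac_ge0)].
move=> phi; rewrite weightE -!EFinM lee_fin mulrA ler_wpM2r ?(gweight_ge0 bfac_ge0)// subr0.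
case: (boolP (s <= `|phi v|)) => h; rewrite ?mulr1 ?mulr0 ?sqr_ge0//.
by rewrite -[leRHS]real_normK ?num_real// lerXn2r ?nnegrE.
Qed.

End Torus.
End Gibbs.

(** * Tail and small ball bounds *)

Section Bounds.
Set Implicit Arguments. Unset Strict Implicit. Unset Printing Implicit Defensive.
Context {R : realType}.

Lemma nrm_le n (v : tvert n) : (nrm v <= (n.-1).+1 * 2)%N.
Proof.
have h (i : 'I_(Defs.tsize n)) : (`|Defs.coord i| <= (n.-1).+1)%N.
  rewrite /Defs.coord; have := ltn_ord i; move: (nat_of_ord i) => j.
  by rewrite /Defs.tsize -addnn; move: (n.-1) => p; lia.
by rewrite /nrm; have := h v.1; have := h v.2; lia.
Qed.

(** The centres are 3 r apart and the radii are r, so at most one window contains y. *)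
Lemma disjoint_windows N (y r : R) : 0 < r ->
  \sum_(j < N) (`|y - 3 * r * j.+1%:R| <= r)%R%:R <= 1 :> R.
Proof.
move=> r0; case: (pickP (fun j : 'I_N => `|y - 3 * r * j.+1%:R| <= r)) => [j hj|h0]; last first.
  by rewrite big1// => j _; rewrite h0.
rewrite (bigD1 j)//= hj big1 ?addr0// => i ij.
apply/eqP; rewrite pnatr_eq0 eqb0; apply/negP => hi.
move: hj hi; rewrite !ler_norml => /andP[a1 a2] /andP[b1 b2].
have sep (a b : nat) : (a < b)%N -> 3 * r * a.+1%:R + 3 * r <= 3 * r * b.+1%:R.
  by move=> ab; rewrite -{2}[3 * r]mulr1 -mulrDr ler_wpM2l ?mulr_ge0 ?(ltW r0)// natr1 ler_nat.
case: (ltngtP i j) => [h|h|/val_inj e]; last by rewrite e eqxx in ij.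
- by have := sep _ _ h; lra.
- by have := sep _ _ h; lra.
Qed.

(** In the allowed range of t the required height is at most theta |v|, with theta = 2 sqrt(ln 2) /
    (1 + ln 2). *)
Lemma range_bound (k lnn : R) : 1 <= k -> ln 2 <= lnn ->  ln (1 + k) <= k * ln 2 ->
  forall t, t <= (1 + Num.sqrt k) / (1 + lnn) ->
  t * Num.sqrt (ln (1 + k)) <= k * (2 * Num.sqrt (ln 2) / (1 + ln 2)).
Proof.
move=> k1 hl hk t ht; set s := Num.sqrt k in ht *.
have l2 := @ln2_ge_half R.
have k0 : 0 <= k by lra.
have s1 : 1 <= s by rewrite -sqrtr1 ler_wsqrtr.
have ss : s * s = k by rewrite -expr2 sqr_sqrtr.
have h1 : t <= 2 * s / (1 + ln 2).
  apply: (le_trans ht); apply: ler_pM.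
  - by lra.
  - by rewrite invr_ge0; lra.
  - by lra.
  - by rewrite lef_pV2 ?posrE; lra.
have h2 : Num.sqrt (ln (1 + k)) <= s * Num.sqrt (ln 2).
  by rewrite -sqrtrM//; exact: ler_wsqrtr.
apply: (@le_trans _ _ (2 * s / (1 + ln 2) * (s * Num.sqrt (ln 2)))).
  apply: (@le_trans _ _ (2 * s / (1 + ln 2) * Num.sqrt (ln (1 + k)))).
    by rewrite ler_wpM2r ?sqrtr_ge0.
  by rewrite ler_wpM2l// divr_ge0; lra.
rewrite le_eqVlt; apply/orP; left; apply/eqP; rewrite -ss; ring.
Qed.

Lemma ln1D_le_mul (k : nat) : ln (1 + k%:R) <= k%:R * ln 2 :> R.
Proof.
have -> : k%:R * ln 2 = ln (2 ^+ k) :> R by rewrite lnXn// mulr_natl.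
rewrite ler_ln ?posrE; [|by rewrite ltr_pwDl|exact: exprn_gt0].
by rewrite -natrX nat1r ler_nat; exact: ltn_expl.
Qed.

Variable U : R -> \bar R.
Hypothesis mU : measurable_fun setT U.
Hypothesis symU : forall x, U x = U (- x).
Variable m : R.
Hypothesis lowU : forall x, (m%:E <= U x)%E.
Hypothesis intU : (\int[lebesgue_measure]_x expeR (- U x) < +oo)%E.
Variable g : R -> R.
Hypothesis dg : forall x, derivable g x 1.
Hypothesis ddg : forall x, derivable (derive1 g) x 1.
Hypothesis cg : continuous (derive1n 2 g).
Hypothesis Ug : forall x : R, -1 <= x <= 1 -> U x = (g x)%:E.

Let z0 n := z_gt0 mU symU lowU intU dg Ug n.
Let gE n := @gintE R U mU symU m lowU intU g dg Ug n.
Let prle n := @pr_le R U mU symU m lowU intU g dg Ug n.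

Lemma rfield_coord_comp n (v : tvert n) (J : R -> bool) : measurable_fun setT J ->
  rfield (fun phi : tvert n -> R => J (phi v)).
Proof. by move=> mJ; apply: (rfield_comp (h := J)) => //; exact: rfield_coord. Qed.

Lemma measurable_ball (c r : R) : measurable_fun setT (fun x : R => `|x - c| <= r).
Proof.
apply: measurable_fun_ler; last exact: measurable_cst.
by apply: measurableT_comp => //; exact: measurable_funB.
Qed.

Lemma measurable_absge (r : R) : measurable_fun setT (fun x : R => r <= `|x|).
Proof. by apply: measurable_fun_ler; [exact: measurable_cst|exact: normr_measurable]. Qed.

Lemma measurable_ge (r : R) : measurable_fun setT (fun x : R => r <= x).
Proof. by apply: measurable_fun_ler; [exact: measurable_cst|exact: measurable_id]. Qed.

(** For fixed n, the field is kept in a small box around a cone of slope below 1 centred at the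
    origin; by [range_bound] the cone exceeds every height that occurs. *)
Lemma tail_small n : (2 <= n)%N -> exists p, 0 < p /\ forall v : tvert n,
  ln (n%:R : R) ^+ 2 <= (nrm v)%:R ->
  forall t, t <= (1 + Num.sqrt (nrm v)%:R) / (1 + ln (n%:R : R)) ->
  p <= pr U (fun phi : tvert n -> R => t * Num.sqrt (ln (1 + (nrm v)%:R)) <= `|phi v|).
Proof.
move=> n2.
have l2 := @ln2_ge_half R; have l2' := @ln2_le1 R.
have ln2lt : ln 2 < 1 :> R.
  have : ln 2 < ln (expR 1) :> R.
    by rewrite ltr_ln ?posrE ?expR_gt0//; have := expR_gt1Dx (oner_neq0 R).
  by rewrite expRK.
set q := Num.sqrt (ln 2 : R).
have qq : q * q = ln 2 by rewrite -expr2 sqr_sqrtr//; lra.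
have q0 : 0 <= q by rewrite sqrtr_ge0.
set th0 := 2 * q / (1 + ln 2).
have th0_ge0 : 0 <= th0 by rewrite divr_ge0 ?mulr_ge0//; lra.
have th0_lt1 : th0 < 1.
  rewrite /th0 ltr_pdivrMr; last by lra.
  (* Strict AM-GM, 2 q < 1 + q^2, gives theta < 1. *)
  have qn1 : q != 1 by apply/eqP => h; move: qq; rewrite h; lra.
  have : 0 < (1 - q) ^+ 2 by rewrite exprn_even_gt0//= subr_eq0 eq_sym.
  by rewrite expr2 -qq; lra.
(* The slope lies halfway between theta and 1, and the box uses up the rest: th1 + 2 kap = 1, while
   th1 k - kap >= th0 k for k >= 1. *)
pose th1 := (1 + th0) / 2; pose kap := (1 - th0) / 4.
have [c [c0 hc]] := bfac_core_gt0 dg Ug.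
have kap0 : 0 < kap by rewrite /kap; lra.
have [th1_ge0 th1k] : 0 <= th1 /\ th1 + 2 * kap = 1 by rewrite /th1 /kap; split; lra.
pose p := c ^+ #|tedge n| * (2 * kap) ^+ size (free_verts n).
have p0 : 0 < p by rewrite mulr_gt0// exprn_gt0// mulr_gt0.
pose Z := fine (gint (bfac U) (fun _ : tvert n -> R => true)).
have Z0 : 0 < Z by exact: z0.
exists (p / Z); split; first by rewrite divr_gt0.
move=> v hv t ht; set T := t * _.
have mb := rfield_coord_comp v (measurable_absge T).
have lnn : ln 2 <= ln n%:R :> R by rewrite ler_ln ?posrE; [rewrite ler_nat|rewrite ltr0n|rewrite ltr0n ltnW].
have k1 : (1 <= nrm v)%N.
  rewrite lt0n; apply/negP => /eqP h; move: hv; rewrite h leNgt => /negP; apply.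
  by rewrite exprn_gt0//; lra.
have hT : T <= (nrm v)%:R * th0.
  by apply: (range_bound _ lnn _ ht); [rewrite ler1n|exact: ln1D_le_mul].
rewrite ler_pdivrMr// -lee_fin -(gE mb).
apply: (@gint_ge_box _ _ mU m lowU _ _ (fun u => th1 * (nrm u)%:R) kap c (ltW c0) (ltW kap0) mb hc).
- by rewrite nrm_origin mulr0.
- move=> e; rewrite inE => /andP[ae _]; rewrite -mulrBr normrM (ger0_norm th1_ge0).
  suff : `|(nrm e.1)%:R - (nrm e.2)%:R| <= 1 :> R.
    by move=> h; have := ler_wpM2l th1_ge0 h; lra.
  have h1 := nrm_step ae; rewrite tadj_sym in ae; have h2 := nrm_step ae.
  have h1' : (nrm e.1)%:R <= (nrm e.2)%:R + 1 :> R by rewrite natr1 ler_nat -addn1.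
  have h2' : (nrm e.2)%:R <= (nrm e.1)%:R + 1 :> R by rewrite natr1 ler_nat -addn1.
  by rewrite ler_norml; lra.
move=> psi0 hpsi; have := hpsi v; rewrite ler_norml => /andP[h1 _].
apply: (le_trans hT); apply: le_trans (ler_norm _).
have k1' : 1 <= (nrm v)%:R :> R by rewrite ler1n.
have : 0 <= (1 - th0) * ((nrm v)%:R - 1) by rewrite mulr_ge0//; lra.
move: h1; rewrite /th1 /kap; lra.
Qed.

Variable eps : R.
Hypothesis eps_gt0 : 0 < eps.
Hypothesis eps_half : eps <= 1 / 2.

Lemma closed_prob_le n : controlled_gradients n U (1 / 8) (1 - eps) ->
  forall S : {set tvert n * tvert n}, S \subset tedge n ->
  (gint (bfac U) (fun phi : tvert n -> R => S \subset closed_edges (1 - eps) phi) <=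
    ((1 / 8) ^+ #|S|)%:E * gint (bfac U) (fun _ : tvert n -> R => true))%E.
Proof.
move=> [_ cgr] S SE.
have mS : rfield (fun phi : tvert n -> R => S \subset closed_edges (1 - eps) phi).
  exact: (@rfield_closed_edges _ _ (1 - eps) (fun B => S \subset B)).
have mt : rfield (fun _ : tvert n -> R => true) by exact: rfield_cst.
rewrite (gE mS) (gE mt) (pr_true mU symU lowU intU dg Ug) mul1r -EFinM lee_fin.
apply: ler_wpM2r; first exact: ltW (z0 n).
(* The controlled gradients speak of nonempty sets; the empty one is trivial. *)
have [->|Sn] := eqVneq S finset.set0.
  rewrite cards0 expr0; apply: (pr_le1 mU symU lowU intU dg Ug).
  exact: (@rfield_closed_edges _ _ (1 - eps) (fun B => finset.set0 \subset B)).
have := cgr S SE Sn; rewrite (Pmu_pr mU symU lowU intU dg Ug (b := fun phi => S \subset closed_edges (1 - eps) phi)) ?lee_fin//.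
move=> phi; split => [h|/fintype.subsetP h e eS].
  apply/fintype.subsetP => e eS; rewrite finset.in_set h// andbT; exact: (fintype.subsetP SE).
by have := h e eS; rewrite finset.in_set => /andP[].
Qed.

(** There are 4 n^2 vertices, and (1/8)^l <= n^(-3) for l = [up_log 2 n]. *)
Lemma not_good_le n : (2 <= n)%N -> controlled_gradients n U (1 / 8) (1 - eps) ->
  pr U (fun phi : tvert n -> R => ~~ good_set (up_log 2 n) (closed_edges (1 - eps) phi)) <= 4 / n%:R.
Proof.
move=> n2 cgr.
have mb : rfield (fun phi : tvert n -> R => ~~ good_set (up_log 2 n) (closed_edges (1 - eps) phi)).
  by apply: rfield_not; exact: rfield_closed_edges.
have mt : rfield (fun _ : tvert n -> R => true) by exact: rfield_cst.
have := not_good_prob (up_log 2 n) (bfac_ge0 U) (measurable_bfac mU lowU) (closed_prob_le cgr).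
rewrite (gE mb) (gE mt) (pr_true mU symU lowU intU dg Ug) mul1r -EFinM lee_fin.
rewrite (ler_pM2r (z0 n)) => h; apply: (le_trans h).
have n0 : 0 < (n%:R : R) by rewrite ltr0n; lia.
have -> : #|{: tvert n}| = (4 * n ^ 2)%N.
  by rewrite card_prod card_ord /Defs.tsize -muln2; case: n n2 {h mb mt cgr n0} => // p _ /=; lia.
have h8 : n%:R ^+ 3 <= 8 ^+ up_log 2 n :> R.
  rewrite -natrX (_ : 8 = (2 ^ 3)%N%:R :> R)// -natrX ler_nat -expnM mulnC expnM leq_exp2r//.
  exact: up_logP.
have e8 : (1 / 8) ^+ up_log 2 n <= (n%:R ^+ 3)^-1 :> R.
  by rewrite div1r exprVn lef_pV2 ?posrE ?exprn_gt0.
apply: (le_trans (ler_wpM2l (ler0n R _) e8)).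
rewrite natrM natrX le_eqVlt; apply/orP; left; apply/eqP.
field; exact: lt0r_neq0.
Qed.

(** Both bounds come from the shift inequality: one translation with an unbalanced weight [lam] for
    the tail, many translations with lam = 1 for the small ball. *)
Lemma large_torus : exists C0 A : R, [/\ 0 <= C0, 0 <= A &
  forall n, (2 <= n)%N -> controlled_gradients n U (1 / 8) (1 - eps) ->
  forall v : tvert n, ln (n%:R : R) ^+ 2 <= (nrm v)%:R -> A <= ln (nrm v)%:R ->
  (forall t, 1 <= t -> t <= (1 + Num.sqrt (nrm v)%:R) / (1 + ln (n%:R : R)) ->
    1 / 16 * expR (- (2 * C0) * t ^+ 2) <=
      pr U (fun phi : tvert n -> R => t * Num.sqrt (ln (1 + (nrm v)%:R)) <= `|phi v|)) /\
  (forall r, 1 <= r -> r / Num.sqrt (ln (1 + (nrm v)%:R)) <= 1 ->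
    pr U (fun phi : tvert n -> R => `|phi v| <= r) <=
      (6 * expR C0 + 8 + 3) * (r / Num.sqrt (ln (1 + (nrm v)%:R))))].
Proof.
have [M [M0 hM]] := bfac_semiconvex dg ddg cg Ug.
have := shift_main (bfac_ge0 U) (measurable_bfac mU lowU) eps_gt0 eps_half M0 hM.
set C0 := (_ / 2 * _); set A := _ + 1.
move=> sm; exists C0, A.
have C00 : 0 <= C0.
  rewrite /C0; apply: mulr_ge0; last by apply: mulr_ge0; [exact: ler0n|exact: sqr_ge0].
  by apply: divr_ge0 => //; apply: addr_ge0 => //; apply: mulr_ge0; [exact: ler0n|exact: sqr_ge0].
have l240 : 0 <= ln 240 :> R by rewrite ln_ge0//; lra.
have A1 : 4 * ln 240 + 1 <= A.
  rewrite /A lerD2r lerDl; apply: mulr_ge0; [exact: ler0n|exact: sqr_ge0].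
clearbody C0 A.
split => //; first by apply: le_trans A1; lra.
move=> n n2 cgr v hn hA; set k : R := (nrm v)%:R in hn hA *.
have lk1 : 1 <= ln k by lra.
have k0 : 0 < k by rewrite ltNge; apply/negP => h; move: lk1; rewrite ln0//; lra.
have k240 : 240 <= k.
  have : ln 240 <= ln k by lra.
  by rewrite ler_ln ?posrE; [|exact: ltr0Sn|exact: k0].
set L := ln (1 + k).
have L0 : 0 < L by rewrite ln_gt0//; lra.
have Lk : L <= k by apply: le_ln1Dx; lra.
set s := Num.sqrt L.
have s0 : 0 < s by rewrite sqrtr_gt0.
have ss : s ^+ 2 = L by rewrite sqr_sqrtr// ltW.
have sk1 : 1 <= Num.sqrt k by rewrite -sqrtr1 ler_wsqrtr//; lra.
have n0 : 0 < (n%:R : R) by rewrite ltr0n ltnW.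
have kn : k <= 2 * n%:R.
  by rewrite -natrM ler_nat mulnC; have := nrm_le v; rewrite prednK// ltnW.
have ngood := not_good_le n2 cgr.
have ng8 : 4 / n%:R <= 8 / k :> R by rewrite ler_pdivlMr// mulrAC ler_pdivrMr//; lra.
pose good (phi : tvert n -> R) := good_set (up_log 2 n) (closed_edges (1 - eps) phi).
have mgood : rfield good by exact: rfield_closed_edges.
have shift T lam (J : R -> bool) : 0 <= T -> T <= 2 * Num.sqrt k * s -> 0 < lam -> measurable_fun setT J ->
   pr U (fun phi : tvert n -> R => good phi && J (phi v)) <= expR (C0 * (T ^+ 2 / L)) / 2 *
    (lam * pr U (fun phi : tvert n -> R => J (phi v - T)) + lam^-1 * pr U (fun phi : tvert n -> R => J (phi v + T))).
  move=> T0 hT lam0 mJ; have := sm n v T lam J n2 hn hA T0 hT lam0 mJ.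
  have m1 : rfield (fun phi : tvert n -> R => good phi && J (phi v)).
    by apply: rfield_and => //; exact: rfield_coord_comp.
  have m2 : rfield (fun phi : tvert n -> R => J (phi v - T)).
    by apply: (rfield_coord_comp v (J := fun x => J (x - T))); apply: measurableT_comp => //; exact: measurable_funB.
  have m3 : rfield (fun phi : tvert n -> R => J (phi v + T)).
    by apply: (rfield_coord_comp v (J := fun x => J (x + T))); apply: measurableT_comp => //; exact: measurable_funD.
  rewrite (gE m1) (gE m2) (gE m3) -!EFinM lee_fin -/k -/L => h.
  by rewrite -(ler_pM2r (z0 n)); apply: (le_trans h); rewrite le_eqVlt; apply/orP; left; apply/eqP; ring.
split.
- move=> t t1 ht; set T := t * s.
  have lnn : 0 <= ln n%:R :> R by rewrite ln_ge0// ler1n ltnW.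
  have T0 : 0 <= T by rewrite mulr_ge0 ?(ltW s0)//; lra.
  have hT : T <= 2 * Num.sqrt k * s.
    rewrite ler_wpM2r ?(ltW s0)//; apply: (le_trans ht).
    rewrite ler_pdivrMr; last by lra.
    have : 2 * Num.sqrt k * 1 <= 2 * Num.sqrt k * (1 + ln n%:R) by rewrite ler_wpM2l//; lra.
    lra.
  have TL : T ^+ 2 / L = t ^+ 2 by rewrite /T exprMn ss mulfK// gt_eqF.
  set K := expR (C0 * t ^+ 2).
  have K0 : 0 < K := expR_gt0 _.
  have K40 : 0 < 4 * K by apply: mulr_gt0 => //; exact: ltr0Sn.
  (* With lam = 4 K the backward translate, of probability at most 1, costs only 1/8, while the left
     side is at least 1/4; hence P1 >= 1 / (16 K^2). *)
  have := shift T (4 * K) (fun x => 0 <= x) T0 hT K40 (measurable_ge 0).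
  rewrite TL -/K.
  set P0 := pr U _; set P1 := pr U _; set P2 := pr U _ => hP.
  have m1 := rfield_coord_comp v (measurable_ge 0).
  have half : 1 / 2 <= pr U (fun phi : tvert n -> R => 0 <= phi v).
    have := pr_split mU symU lowU intU dg Ug (rfield_cst true) m1.
    rewrite (pr_true mU symU lowU intU dg Ug).
    rewrite (_ : (fun phi : tvert n -> R => (0 <= phi v) && true) = (fun phi => 0 <= phi v)); last first.
      by apply/funext => phi; rewrite andbT.
    have : pr U (fun phi : tvert n -> R => ~~ (0 <= phi v)) <= pr U (fun phi : tvert n -> R => 0 <= - phi v).
      apply: prle; first exact: rfield_not.
      - by apply: (rfield_coord_comp v (J := fun x => 0 <= - x)); apply: measurable_fun_ler => //; exact: measurable_funN.
      - by move=> phi; rewrite -ltNge oppr_ge0; exact: ltW.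
    rewrite (pr_opp mU symU lowU m1); lra.
  have P0ge : 1 / 4 <= P0.
    have := pr_split mU symU lowU intU dg Ug m1 mgood; rewrite -/P0.
    have : 8 / k <= 1 / 4 by rewrite ler_pdivrMr//; lra.
    move: ngood; rewrite -/good; lra.
  have P2le : P2 <= 1.
    apply: (pr_le1 mU symU lowU intU dg Ug).
    apply: (rfield_coord_comp v (J := fun x => 0 <= x + T)); apply: measurable_fun_ler => //; exact: measurable_funD.
  have P1le : P1 <= pr U (fun phi : tvert n -> R => T <= `|phi v|).
    apply: prle.
    - by apply: (rfield_coord_comp v (J := fun x => 0 <= x - T)); apply: measurable_fun_ler => //; exact: measurable_funB.
    - exact: (rfield_coord_comp v (measurable_absge T)).
    - by move=> phi; rewrite subr_ge0 => h; apply: (le_trans h); exact: ler_norm.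
  apply: le_trans P1le.
  have Ki : (4 * K)^-1 * P2 <= (4 * K)^-1 * 1 by rewrite ler_wpM2l// invr_ge0; lra.
  have e1 : K / 2 * (4 * K * P1 + (4 * K)^-1) = 2 * K ^+ 2 * P1 + 1 / 8 by field; exact: lt0r_neq0.
  have h1 : 1 / 4 <= 2 * K ^+ 2 * P1 + 1 / 8.
    rewrite -e1; apply: (le_trans P0ge); apply: (le_trans hP).
    by rewrite ler_wpM2l//; [lra|rewrite mulr1 in Ki; lra].
  have -> : expR (- (2 * C0) * t ^+ 2) = (K ^+ 2)^-1.
    by rewrite -expRM_natl -expRN; congr expR; ring.
  rewrite ler_pdivrMr ?exprn_gt0//; lra.
move=> r r1 x1; set x := r / s in x1 *.
have mball := rfield_coord_comp v (measurable_ball 0 r).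
have mb : rfield (fun phi : tvert n -> R => `|phi v| <= r).
  by apply: (rfield_coord_comp v (J := fun x => `|x| <= r)); apply: measurable_fun_ler => //; exact: normr_measurable.
have x0 : 0 < x by rewrite divr_gt0//; lra.
have e0 : 0 < expR C0 := expR_gt0 _.
have [x3|x3] := ltP (1 / 3) x.
  apply: (le_trans (pr_le1 mU symU lowU intU dg Ug mb)).
  have : 0 <= (6 * expR C0 + 8) * x by rewrite mulr_ge0//; lra.
  lra.
(* The number of windows is chosen so that every shift 3 r j is at most s, which bounds the factor
   by exp(C0). *)
pose N := Num.truncn (1 / (3 * x)).
have y0 : 0 <= 1 / (3 * x) by rewrite divr_ge0//; lra.
have /andP[N1 N2] := truncn_itv y0; rewrite -/N in N1 N2.
have Ngt0 : (0 < N)%N.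
  rewrite lt0n; apply/negP => /eqP h; move: N2; rewrite h ltNge => /negP; apply.
  by rewrite ler_pdivlMr; lra.
have NR : 1 <= N%:R :> R by rewrite ler1n.
have rs : r = x * s by rewrite /x divfK// gt_eqF.
set P := pr U (fun phi : tvert n -> R => good phi && (`|phi v| <= r)).
have each (j : 'I_N) : P <= expR C0 / 2 * (pr U (fun phi : tvert n -> R => `|phi v - 3 * r * j.+1%:R| <= r) +
     pr U (fun phi : tvert n -> R => `|- phi v - 3 * r * j.+1%:R| <= r)).
  set T := 3 * r * j.+1%:R.
  have T0 : 0 <= T by rewrite !mulr_ge0//; lra.
  have Ts : T <= s.
    have jN : j.+1%:R <= N%:R :> R by rewrite ler_nat.
    have h1 : 3 * r * j.+1%:R <= 3 * r * (1 / (3 * x)) by rewrite ler_wpM2l//; lra.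
    by apply: (le_trans h1); rewrite le_eqVlt rs; apply/orP; left; apply/eqP; field; exact: lt0r_neq0.
  have hT : T <= 2 * Num.sqrt k * s.
    apply: (le_trans Ts); rewrite ler_peMl ?(ltW s0)//; lra.
  have mJ : measurable_fun setT (fun y : R => `|y| <= r).
    by apply: measurable_fun_ler => //; exact: normr_measurable.
  have := shift T 1 _ T0 hT ltr01 mJ; rewrite invr1 !mul1r => h; apply: (le_trans h).
  have q1 : expR (C0 * (T ^+ 2 / L)) <= expR C0.
    rewrite ler_expR ler_piMr// ler_pdivrMr// mul1r -ss.
    by apply: lerXn2r => //; rewrite nnegrE ltW.
  have -> : (fun phi : tvert n -> R => `|phi v + T| <= r) = (fun phi : tvert n -> R => `|- phi v - T| <= r).
    by apply/funext => phi; rewrite -normrN opprD.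
  rewrite ler_wpM2r ?addr_ge0 ?(pr_ge0 mU symU lowU intU dg Ug)//; lra.
have r0 : 0 < r by lra.
have sum1 : \sum_(j < N) pr U (fun phi : tvert n -> R => `|phi v - 3 * r * j.+1%:R| <= r) <= 1.
  rewrite -[leRHS](pr_true mU symU lowU intU dg Ug n).
  apply: (pr_sum_le mU symU lowU intU dg Ug) => //.
  - by move=> j; exact: (rfield_coord_comp v (measurable_ball (3 * r * j.+1%:R) r)).
  - by move=> phi; exact: disjoint_windows.
have sum2 : \sum_(j < N) pr U (fun phi : tvert n -> R => `|- phi v - 3 * r * j.+1%:R| <= r) <= 1.
  apply: le_trans sum1; apply: ler_sum => j _.
  by rewrite (pr_opp mU symU lowU (rfield_coord_comp v (measurable_ball (3 * r * j.+1%:R) r))).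
have NP : N%:R * P <= expR C0.
  have -> : N%:R * P = \sum_(j < N) P by rewrite sumr_const card_ord mulr_natl.
  apply: (@le_trans _ _ (\sum_(j < N) expR C0 / 2 * (pr U (fun phi : tvert n -> R => `|phi v - 3 * r * j.+1%:R| <= r) +
     pr U (fun phi : tvert n -> R => `|- phi v - 3 * r * j.+1%:R| <= r)))).
    by apply: ler_sum => j _; exact: each.
  rewrite -mulr_sumr big_split/=.
  have h2 := lerD sum1 sum2.
  have ch : 0 <= expR C0 / 2 by lra.
  by apply: (le_trans (ler_wpM2l ch h2)); lra.
have Px : P <= 6 * expR C0 * x.
  have P0 : 0 <= P by exact: (pr_ge0 mU symU lowU intU dg Ug).
  have h1 : 1 / (3 * x) <= 2 * N%:R by apply: (le_trans (ltW N2)); rewrite -natr1; lra.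
  have h2 : 1 <= 6 * x * N%:R by move: h1; rewrite ler_pdivrMr; lra.
  have h3 : P * 1 <= P * (6 * x * N%:R) by rewrite ler_wpM2l.
  have h4 : 6 * x * (N%:R * P) <= 6 * x * expR C0 by rewrite ler_wpM2l//; lra.
  lra.
(* The event of a bad closed set is absorbed using r >= 1 and s <= k. *)
have kx : 8 / k <= 8 * x.
  rewrite ler_pdivrMr//.
  have sk : s <= k.
    apply: (@le_trans _ _ (Num.sqrt k)); first exact: ler_wsqrtr.
    by rewrite -{2}(sqr_sqrtr (ltW k0)) expr2 ler_peMr//; lra.
  have : x * s <= x * k by rewrite ler_wpM2l// ltW.
  by rewrite -rs; lra.
have := pr_split mU symU lowU intU dg Ug mb mgood; rewrite -/P.
move: ngood; rewrite -/good; lra.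
Qed.

End Bounds.

(** * Choice of the constants *)

Lemma finite_min_gt0 (R : realType) (P : nat -> R -> Prop) (N : nat) :
  (forall n p q, P n p -> q <= p -> P n q) -> (forall n, exists p, 0 < p /\ P n p) ->
  exists c, 0 < c /\ forall n, (n <= N)%N -> P n c.
Proof.
move=> down h; elim: N => [|N [c [c0 hc]]].
  by have [p [p0 hp]] := h 0%N; exists p; split => // n; rewrite leqn0 => /eqP ->.
have [p [p0 hp]] := h N.+1; exists (Num.min c p); split; first by rewrite lt_min c0.
move=> n; rewrite leq_eqVlt => /predU1P[->|nN].
- by apply: down hp _; rewrite ge_min lexx orbT.
- by apply: down (hc n nN) _; rewrite ge_min lexx.
Qed.

Theorem theorem4p1 (R : realType) (U : R -> \bar R) (eps : R) :
  measurable_fun setT U ->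
  (forall x : R, U x = U (- x)) ->
  (exists m : R, forall x : R, (m%:E <= U x)%E) ->
  (0 < \int[lebesgue_measure]_x expeR (- U x))%E ->
  (\int[lebesgue_measure]_x expeR (- U x) < +oo)%E ->
  C2_on_unit U ->
  0 < eps -> eps <= 1 / 2 ->
  exists C c : R, 0 < C /\ 0 < c /\
    forall n : nat, (2 <= n)%N ->
    controlled_gradients n U (1 / 8) (1 - eps) ->
    forall v : tvert n, ln (n%:R : R) ^+ 2 <= (norm1 v)%:~R ->
      ((c * ln (1 + (norm1 v)%:~R))%:E <= var U v)%E /\
      (forall r : R, 1 <= r ->
         (Pmu U [set phi | (`|phi v| <= r)%R]
            <= (C * (r / Num.sqrt (ln (1 + (norm1 v)%:~R))) `^ (2 / 3))%:E)%E) /\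
      (forall t : R, 1 <= t ->
         t <= (1 + Num.sqrt ((norm1 v)%:~R)) / (1 + ln (n%:R : R)) ->
         ((c * expR (- C * t ^+ 2))%:E
            <= Pmu U [set phi | (t * Num.sqrt (ln (1 + (norm1 v)%:~R)) <= `|phi v|)%R])%E).
Proof.
move=> mU symU [m lowU] _ intU [g [dg [ddg [cg Ug]]]] eps0 epsh.
have [C0 [A [C00 A0 large]]] := large_torus mU symU lowU intU dg ddg cg Ug eps0 epsh.
(* If ln |v| < A then (log n)^2 <= |v| <= exp(A), so n <= N: only these n are left to
   [tail_small]. *)
pose N := (Num.truncn (expR (Num.sqrt (expR A)))).+1.
pose tailP (n : nat) (p : R) := (2 <= n)%N -> forall v : tvert n,
  ln (n%:R : R) ^+ 2 <= (nrm v)%:R ->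
  forall t, t <= (1 + Num.sqrt (nrm v)%:R) / (1 + ln (n%:R : R)) ->
  p <= pr U (fun phi : tvert n -> R => t * Num.sqrt (ln (1 + (nrm v)%:R)) <= `|phi v|).
have [c1 [c10 hc1]] : exists c, 0 < c /\ forall n, (n <= N)%N -> tailP n c.
  apply: finite_min_gt0 => [n p q hp qp n2 v hv t ht|n]; first exact: (le_trans qp (hp n2 v hv t ht)).
  case: (leqP 2 n) => n2; last by exists 1; split => //; rewrite /tailP leqNgt n2.
  have [p [p0 hp]] := tail_small mU symU lowU intU dg Ug n2.
  by exists p; split => // _.
pose sA := Num.sqrt (ln (1 + expR A)).
have sA0 : 0 <= sA by rewrite sqrtr_ge0.
have eC0 : 0 < expR C0 := expR_gt0 _.
(* The summands serve the Gaussian tail, the small ball bound for large |v|, and the small ball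
   bound when |v| < exp(A). *)
pose C := 2 * C0 + (6 * expR C0 + 8 + 3) + sA.
have C_ge : [/\ 2 * C0 <= C, 6 * expR C0 + 8 + 3 <= C, sA <= C & 1 <= C].
  by rewrite /C; split; lra.
have [Ca Cb Cc Cd] := C_ge.
pose c2 := Num.min (1 / 16) c1.
have c20 : 0 < c2 by rewrite lt_min c10 andbT; lra.
have c2a : c2 <= 1 / 16 by rewrite ge_min lexx.
have c2b : c2 <= c1 by rewrite ge_min lexx orbT.
have tail n : (2 <= n)%N -> controlled_gradients n U (1 / 8) (1 - eps) ->
    forall v : tvert n, ln (n%:R : R) ^+ 2 <= (nrm v)%:R -> forall t, 1 <= t ->
    t <= (1 + Num.sqrt (nrm v)%:R) / (1 + ln (n%:R : R)) ->
    c2 * expR (- C * t ^+ 2) <= pr U (fun phi : tvert n -> R => t * Num.sqrt (ln (1 + (nrm v)%:R)) <= `|phi v|).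
  move=> n2 cgr v hv t t1 ht.
  have t20 : 0 <= t ^+ 2 := sqr_ge0 t.
  have [hA|hA] := leP A (ln (nrm v)%:R).
    have [h _] := large n n2 cgr v hv hA; apply: le_trans (h t t1 ht).
    apply: ler_pM => //; first exact: ltW.
    by rewrite ler_expR !mulNr lerN2 ler_wpM2r.
  have nN : (n <= N)%N.
    have n0 : 0 < (n%:R : R) by rewrite ltr0n ltnW.
    have vA : (nrm v)%:R <= expR A.
      have [v0|v0] := posnP (nrm v); first by rewrite v0 expR_ge0.
      by rewrite -[leLHS]lnK ?posrE ?ltr0n// ler_expR ltW.
    have lnn : ln n%:R <= Num.sqrt (expR A).
      have := ler_wsqrtr (le_trans hv vA); rewrite sqrtr_sqr; exact/le_trans/ler_norm.
    have ne : n%:R <= expR (Num.sqrt (expR A)) by rewrite -[leLHS]lnK ?posrE// ler_expR.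
    have /andP[_ h] := truncn_itv (expR_ge0 (Num.sqrt (expR A))).
    by rewrite -(ler_nat R) ltW// (le_lt_trans ne).
  apply: le_trans (hc1 n nN n2 v hv t ht).
  apply: le_trans c2b; rewrite ler_piMr ?(ltW c20)// -expR0 ler_expR mulNr oppr_le0.
  by apply: mulr_ge0 => //; lra.
(* The extra factor exp(-C) is the tail at t = 1, which gives the variance. *)
exists C, (c2 * expR (- C)); split; first lra.
split; first by rewrite mulr_gt0// expR_gt0.
have eC1 : expR (- C) <= 1 by rewrite -expR0 ler_expR oppr_le0; lra.
move=> n n2 cgr v; rewrite norm1E -pmulrn => hv; set k : R := (nrm v)%:R in hv *.
have lnn2 : 1 / 2 <= ln n%:R :> R.
  by apply: (le_trans ln2_ge_half); rewrite ler_ln ?posrE; [rewrite ler_nat|rewrite ltr0n|rewrite ltr0n ltnW].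
have k0 : 0 < k by apply: lt_le_trans hv; apply: exprn_gt0; lra.
have k1 : 1 <= k by move: k0; rewrite /k ltr0n ler1n.
have L0 : 0 < ln (1 + k) by rewrite ln_gt0//; lra.
set s := Num.sqrt (ln (1 + k)).
have s0 : 0 < s by rewrite sqrtr_gt0.
have ss : s ^+ 2 = ln (1 + k) by rewrite sqr_sqrtr// ltW.
have mge c : rfield (fun phi : tvert n -> R => c <= `|phi v|) := rfield_coord_comp v (measurable_absge c).
have mle r : rfield (fun phi : tvert n -> R => `|phi v| <= r).
  apply: (rfield_coord_comp v (J := fun x => `|x| <= r)).
  by apply: measurable_fun_ler => //; exact: normr_measurable.
split; [|split].
- apply: le_trans (var_ge mU symU lowU intU dg Ug v (ltW s0)).
  rewrite lee_fin -ss mulrC ler_wpM2l ?sqr_ge0//.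
  have lnk : ln n%:R <= Num.sqrt k.
    by have := ler_wsqrtr hv; rewrite sqrtr_sqr; exact/le_trans/ler_norm.
  (* The value t = 1 is admissible because ln n <= sqrt k. *)
  have h1 : 1 <= (1 + Num.sqrt k) / (1 + ln n%:R) by rewrite ler_pdivlMr; lra.
  have := tail n n2 cgr v hv 1 (lexx _) h1.
  by rewrite expr1n mulr1 mul1r.
- move=> r r1.
  rewrite (Pmu_pr mU symU lowU intU dg Ug (b := fun phi => `|phi v| <= r))// lee_fin.
  set x := r / s.
  have x0 : 0 < x by rewrite divr_gt0//; lra.
  have p1 := pr_le1 mU symU lowU intU dg Ug (mle r).
  have [x1|x1] := leP 1 x.
    have h23 : 0 <= 2 / 3 :> R by lra.
    have := ler_powR x1 h23; rewrite powRr0 => h.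
    by apply: (le_trans p1); apply: (le_trans Cd); rewrite ler_peMr//; lra.
  (* For x <= 1 a bound linear in x implies the one with exponent 2/3. *)
  have xx : x <= x `^ (2 / 3).
    have h23 : 2 / 3 <= 1 :> R by lra.
    have x01 : 0 < x <= 1 by rewrite x0 ltW.
    by have := ger_powR x01 h23; rewrite powRr1// ltW.
  have C_ge0 : 0 <= C by lra.
  apply: le_trans (ler_wpM2l C_ge0 xx).
  have [hA|hA] := leP A (ln k).
    have [_ h] := large n n2 cgr v hv hA.
    apply: (le_trans (h r r1 (ltW x1))); rewrite ler_wpM2r ?(ltW x0)//.
  apply: (le_trans p1).
  (* Here |v| < exp(A), so s <= sA <= C and C x >= s x = r >= 1, which bounds any probability. *)
  have ssA : s <= sA.
    rewrite ler_wsqrtr// ler_ln ?posrE; [|lra|by have := expR_gt0 A; lra].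
    by rewrite lerD2l -[leLHS]lnK ?posrE// ler_expR ltW.
  have : s * x <= C * x by rewrite ler_wpM2r ?(ltW x0)// (le_trans ssA).
  have -> : s * x = r by rewrite /x mulrC divfK// gt_eqF.
  by apply: le_trans.
- move=> t t1 ht.
  rewrite (Pmu_pr mU symU lowU intU dg Ug (b := fun phi => t * s <= `|phi v|))// lee_fin.
  apply: le_trans (tail n n2 cgr v hv t t1 ht).
  by rewrite ler_wpM2r ?expR_ge0// ler_piMr ?(ltW c20).
Qed.
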